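(* Let $\alpha>0$, let $\mathcal X,\mathcal Y$ be separable metric spaces, and let $(\mathbf X,\mathbf Y)$ be a pair of random variables in $\mathcal X\times\mathcal Y$. Let $$E_1:=\mathbb E[d(\mathbf X_1,\mathbf X_2)^\alpha d(\mathbf Y_1,\mathbf Y_2)^\alpha],\quad E_2:=\mathbb E[d(\mathbf X_1,\mathbf X_2)^\alpha]\,\mathbb E[d(\mathbf Y_1,\mathbf Y_2)^\alpha],\quad E_3:=\mathbb E[d(\mathbf X_1,\mathbf X_2)^\alpha d(\mathbf Y_1,\mathbf Y_3)^\alpha].$$ (i) If $\mathbb E\|\mathbf X\|^\alpha+\mathbb E\|\mathbf Y\|^\alpha+\mathbb E[\|\mathbf X\|^\alpha\|\mathbf Y\|^\alpha]<\infty$, then all the expectations occurring in $E_1,E_2,E_3$ are finite, so that $\mathrm{dcov}^*_\alpha(\mathbf X,\mathbf Y):=E_1+E_2-2E_3$ is defined as a finite number. Moreover, in this case $\widehat{\mathrm{dcov}}_\alpha(\mathbf X,\mathbf Y)$ and $\widetilde{\mathrm{dcov}}_\alpha(\mathbf X,\mathbf Y)$ also yield the same result, i.e. $\mathrm{dcov}^*_\alpha(\mathbf X,\mathbf Y)=\widehat{\mathrm{dcov}}_\alpha(\mathbf X,\mathbf Y)=\widetilde{\mathrm{dcov}}_\alpha(\mathbf X,\mathbf Y)$. (ii) Conversely, if $\mathbb E\|\mathbf X\|^\alpha+\mathbb E\|\mathbf Y\|^\alpha+\mathbb E[\|\mathbf X\|^\alpha\|\mathbf Y\|^\alpha]=\infty$,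 and $\mathbf X$ and $\mathbf Y$ are non-degenerate, then $E_1+E_2-2E_3$ is of the type $\infty-\infty$ (i.e. $E_1+E_2=\infty$ and $E_3=\infty$) and thus meaningless.
   Context: Both metrics are denoted $d$. Fix points $\mathbf x_o\in\mathcal X$, $\mathbf y_o\in\mathcal Y$ and write $\|\mathbf x\|:=d(\mathbf x,\mathbf x_o)$, $\|\mathbf y\|:=d(\mathbf y,\mathbf y_o)$. Let $(\mathbf X_i,\mathbf Y_i)$, $i\ge1$, be independent copies of $(\mathbf X,\mathbf Y)$. A random variable is degenerate if it is concentrated at a single value, i.e. a.s. constant. $\widehat{\mathrm{dcov}}_\alpha(\mathbf X,\mathbf Y):=\frac14\mathbb E[\widehat X_\alpha\widehat Y_\alpha]$ (when this expectation exists), where $\widehat X_\alpha:=d(\mathbf X_1,\mathbf X_2)^\alpha-d(\mathbf X_2,\mathbf X_3)^\alpha+d(\mathbf X_3,\mathbf X_4)^\alpha-d(\mathbf X_4,\mathbf X_1)^\alpha$ and $\widehat Y_\alpha$ is defined in the same way with $\mathbf Y_i$. $\widetilde{\mathrm{dcov}}_\alpha(\mathbf X,\mathbf Y):=\mathbb E[\widetilde X_\alpha\widetilde Y_\alpha]$ (when $\widehat X_\alpha,\widehat Y_\alpha\in L^1$ and this expectation exists), where $\widetilde X_\alpha:=\mathbb E(\widehat X_\alpha\mid\mathbf X_1,\mathbf X_2)$ and $\widetilde Y_\alpha:=\mathbb E(\widehat Y_\alpha\mid\mathbf Y_1,\mathbf Y_2)$. *)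

(* Defs.v *)
From HB Require Import structures.
From mathcomp Require Import all_boot all_order all_algebra finmap.
From mathcomp Require Import all_classical all_reals all_analysis.

Set Implicit Arguments.
Unset Strict Implicit.
Unset Printing Implicit Defensive.

Import Order.TTheory GRing.Theory Num.Theory.
Import numFieldNormedType.Exports.

Local Open Scope classical_set_scope.
Local Open Scope ring_scope.

(* Measurable types are pointed in the library, so the metric spaces carrying
   random variables are taken nonempty, with an otherwise unused point. *)
#[short(type="pmetricType")]
HB.structure Definition PMetric (K : numDomainType) :=
  {M of Metric K M & Pointed M}.

Definition separable (T : topologicalType) : Prop :=
  exists2 D : set T, countable D & dense D.

(* The metric space T with its Borel sigma-algebra. *)
Notation borelType T := (g_sigma_algebraType (@open T)).

Notation "''d' ( x , y )" := (@mdist _ _ x y)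
  (at level 0, format "''d' ( x ,  y )") : ring_scope.

Section independent_copies.
Context {d d' dT : measure_display} {R : realType}.
Context {Omega : measurableType d} {Omega' : measurableType d'}.
Context {T : measurableType dT}.
Implicit Types (P : probability Omega R) (Q : probability Omega' R).

Definition independent_family {I : choiceType} P (Z : I -> Omega -> T) : Prop :=
  forall (J : {fset I}) (A : I -> set T),
    (forall i, i \in J -> measurable (A i)) ->
    P (\bigcap_(i in [set` J]) (Z i @^-1` A i)) =
      (\prod_(i <- J) P (Z i @^-1` A i))%E.

Definition same_law P (Z : Omega -> T) Q (W : Omega' -> T) : Prop :=
  forall A : set T, measurable A -> P (Z @^-1` A) = Q (W @^-1` A).

Definition independent_copies P (Z : nat -> Omega -> T)
    Q (W : Omega' -> T) : Prop :=
  independent_family P Z /\ forall i, same_law P (Z i) Q W.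

End independent_copies.

Section expectations.
Context {d : measure_display} {R : realType} {Omega : measurableType d}.
Variable P : probability Omega R.

(* g is a version of E(f | G), for G a sub-sigma-algebra and f integrable. *)
Definition is_cond_expectation (G : set (set Omega)) (f g : Omega -> R) : Prop :=
  [/\ forall B : set R, measurable B -> G (g @^-1` B),
      P.-integrable setT (EFin \o g) &
      forall A, G A ->
        (\int[P]_(w in A) (g w)%:E = \int[P]_(w in A) (f w)%:E)%E].

Definition degenerate (T : pmetricType R) (X : {RV P >-> borelType T}) : Prop :=
  exists x : T, {ae P, forall w, X w = x}.

End expectations.

(* The sequences below are indexed from 0: X i stands for X_{i+1}. *)
Section distance_covariance.
Context {d : measure_display} {R : realType} {Omega : measurableType d}.
Context {P : probability Omega R}.
Variable a : R.

Section one_space.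
Context {T : pmetricType R}.
Variable X : nat -> {RV P >-> borelType T}.

Definition dist_pow (i j : nat) (w : Omega) : R :=
  'd((X i w : T), (X j w : T)) `^ a.

Definition hat (w : Omega) : R :=
  dist_pow 0 1 w - dist_pow 1 2 w + dist_pow 2 3 w - dist_pow 3 0 w.

(* g is a version of E(hat | X_1, X_2). *)
Definition is_tilde (g : Omega -> R) : Prop :=
  is_cond_expectation P (g_sigma_preimageU (X 0%N) (X 1%N)) hat g.

End one_space.

Context {SX SY : pmetricType R}.
Variables (X : nat -> {RV P >-> borelType SX}).
Variables (Y : nat -> {RV P >-> borelType SY}).

Local Open Scope ereal_scope.

Definition E1 : \bar R := 'E_P[fun w => (dist_pow X 0 1 w * dist_pow Y 0 1 w)%R].

Definition E2 : \bar R := 'E_P[dist_pow X 0 1] * 'E_P[dist_pow Y 0 1].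

Definition E3 : \bar R := 'E_P[fun w => (dist_pow X 0 1 w * dist_pow Y 0 2 w)%R].

Definition dcov_star : \bar R := E1 + E2 - 2%:E * E3.

Definition is_dcov_hat (v : \bar R) : Prop :=
  P.-integrable setT (fun w => (hat X w * hat Y w)%:E) /\
  4^-1%:E * 'E_P[fun w => (hat X w * hat Y w)%R] = v.

(* Conditional expectations are only determined almost surely: they must exist,
   and the value v must be obtained from every choice of versions. *)
Definition is_dcov_tilde (v : \bar R) : Prop :=
  [/\ P.-integrable setT (EFin \o hat X) /\ P.-integrable setT (EFin \o hat Y),
      (exists tX, is_tilde X tX) /\ (exists tY, is_tilde Y tY) &
      forall tX tY : Omega -> R, is_tilde X tX -> is_tilde Y tY ->
        P.-integrable setT (fun w => (tX w * tY w)%:E) /\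
        'E_P[fun w => (tX w * tY w)%R] = v].

End distance_covariance.

Section moments.
Context {d : measure_display} {R : realType} {Omega : measurableType d}.
Context {P : probability Omega R}.
Context {SX SY : pmetricType R}.
Local Open Scope ereal_scope.

(* E|X|^a + E|Y|^a + E[|X|^a |Y|^a], with |x| = d(x, xo) and |y| = d(y, yo). *)
Definition moment_sum (a : R) (xo : SX) (yo : SY)
    (X : {RV P >-> borelType SX}) (Y : {RV P >-> borelType SY}) : \bar R :=
  'E_P[fun w => ('d((X w : SX), xo) `^ a)%R] +
  'E_P[fun w => ('d((Y w : SY), yo) `^ a)%R] +
  'E_P[fun w => ('d((X w : SX), xo) `^ a * 'd((Y w : SY), yo) `^ a)%R].

End moments.

(* Main.v *)
Require Import Defs.
From HB Require Import structures.
From mathcomp Require Import all_boot all_order all_algebra finmap.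
From mathcomp Require Import all_classical all_reals all_analysis.
From mathcomp Require Import measurable_realfun ring lra.


(* Let k(z, z') = d(x, x')^a and l(z, z') = d(y, y')^a for z = (x, y), let Q be
   the law of (X, Y), let phi(z) = E k(z, Z) and lambda(z) = E l(z, Z) be the
   potentials of k and l, and let u(z) = |x|^a and v(z) = |y|^a.  By Tonelli,
   E_1 is the double integral of k l, E_2 = (int phi)(int lambda) and
   E_3 = int phi lambda.

   In (i), d(x, x')^a <= 2^a (|x|^a + |x'|^a) gives finiteness.  Both
   remaining covariances are expectations of products of two alternating sums of
   four terms: for the hat version the terms are k(Z_i, Z_(i+1)), for the tilde
   version, whose conditional expectation can be computed explicitly, they are
   k(Z_1, Z_2), phi(Z_2), E k(Z_1, Z_2), phi(Z_1).  Each of the sixteen products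
   has expectation E_1, E_2 or E_3.

   In (ii), if E|X|^a = oo then phi = oo everywhere, while lambda > 0 everywhere
   by non-degeneracy, so E_2 = E_3 = oo; symmetrically for Y.  If only
   E[|X|^a |Y|^a] is infinite, then E_1 < oo would give a point z_0 with
   E[k(z_0, Z) l(z_0, Z)] < oo, and u <= 2^a (k(z_0, .) + u(z_0)), with the same
   bound for v, makes E[u v] finite; E_3 < oo is excluded by
   u <= 2^a (phi + E|X|^a). *)

Set Implicit Arguments.
Unset Strict Implicit.
Unset Printing Implicit Defensive.

Import Order.TTheory GRing.Theory Num.Theory.
Import numFieldNormedType.Exports.

Local Open Scope classical_set_scope.
Local Open Scope ring_scope.

(** * Joint measurability of the distance *)

Lemma open_mdist_lt {R : realType} (T : pmetricType R) (q : T) (s : R) :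
  open [set x : T | 'd(x, q) < s].
Proof.
rewrite openE => x /= xqs; apply/nbhs_ballP.
exists (s - 'd(x, q)) => /=; first by rewrite subr_gt0.
move=> y; rewrite ballEmdist /= => xy.
by rewrite (le_lt_trans (metric_triangle _ x _))// metric_sym -ltrBrDr.
Qed.

(* Without separability the distance need not be measurable for the product of
   the Borel sigma-algebras: here [{d(x, y) < r}] is the union of
   [{d(x, q) + d(y, q) < r}] over [q] in a countable dense set. *)
Lemma measurable_mdist {R : realType} (T : pmetricType R) : separable T ->
  measurable_fun [set: borelType T * borelType T]
    (fun z => 'd((z.1 : T), (z.2 : T))).
Proof.
move=> [D cD dD] mT.
(* With one argument fixed, the sublevel sets of the distance are open, hence Borel. *)
have m1 (q : T) : measurable_fun setT (fun x : borelType T => 'd((x : T), q)).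
  move=> ?; apply: (measurability _ (RGenInftyO.measurableE R)) => //.
  move=> _ [_ [r ->] <-]; rewrite setTI; apply: sub_sigma_algebra.
  rewrite (_ : _ @^-1` _ = [set x : T | 'd(x, q) < r]).
    exact: open_mdist_lt.
  by apply/seteqP; split => x /=; rewrite in_itv.
apply: (measurability _ (RGenInftyO.measurableE R)) => //.
move=> _ [_ [r ->] <-]; rewrite setTI.
rewrite (_ : _ @^-1` _ = \bigcup_(q in D)
  [set z : borelType T * borelType T | 'd((z.1 : T), q) + 'd((z.2 : T), q) < r]).
  rewrite bigcup_set_type; apply: countable_bigcupT_measurable.
    by rewrite (eq_countable (card_setT _)).
  move=> q; set f := fun z : borelType T * borelType T =>
    'd((z.1 : T), val q) + 'd((z.2 : T), val q).
  have mf : measurable_fun setT f.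
    apply: measurable_funD.
      exact: (measurableT_comp (m1 (val q)) measurable_fst).
    exact: (measurableT_comp (m1 (val q)) measurable_snd).
  rewrite (_ : [set z | _] = setT `&` f @^-1` `]-oo, r[).
    exact: mf.
  by rewrite setTI; apply/seteqP; split => z /=; rewrite in_itv.
apply/seteqP; split => [[x y]|[x y] [q Dq]] /=; rewrite in_itv/=; last first.
  apply: le_lt_trans; rewrite (metric_sym y); exact: metric_triangle.
(* A point [q] of the dense set closer to [x] than half the gap [r - d(x, y)] suffices, since [d(x,
   q) + d(y, q) <= d(x, y) + 2 d(x, q) < r]. *)
move=> xyr; pose e := (r - 'd((x : T), (y : T))) / 2.
have e0 : 0 < e by rewrite divr_gt0// subr_gt0.
have [|q [/= qe Dq]] := dD _ _ (@open_mdist_lt _ T x e).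
  by exists x; rewrite /= mdistxx.
exists q => //=.
have qy : 'd((y : T), q) <= 'd((x : T), (y : T)) + 'd(q, (x : T)).
  by rewrite addrC metric_sym; exact: metric_triangle.
have xq : 'd((x : T), q) = 'd(q, (x : T)) by rewrite metric_sym.
rewrite xq; move: qe qy; rewrite /e; lra.
Qed.

(** * Joint law of independent copies *)

Lemma measurable_preimageT {d1 d2} {T1 : measurableType d1}
    {T2 : measurableType d2} (f : T1 -> T2) A :
  measurable_fun setT f -> measurable A -> measurable (f @^-1` A).
Proof. by move=> mf mA; rewrite -[X in measurable X]setTI; exact: mf. Qed.

Section product_probability.
Context {d1 d2 : measure_display} {T1 : measurableType d1}.
Context {T2 : measurableType d2} {R : realType}.
Variables (Q1 : probability T1 R) (Q2 : probability T2 R).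
Local Open Scope ereal_scope.

(** Registering [Q1 \x Q2] as a probability lets four copies be handled as a pair of independent
    pairs, each with law [Q \x Q]. *)
Let product_probability_setT : (Q1 \x Q2) [set: T1 * T2] = 1.
Proof.
transitivity (Q1 setT * Q2 setT); last by rewrite !probability_setT mule1.
by rewrite -setXTT product_measure1E.
Qed.

HB.instance Definition _ := Measure_isProbability.Build _ _ _ (Q1 \x Q2)
  product_probability_setT.

End product_probability.

(** The image of [nu] under [(V, W)] agrees with the product measure on rectangles, hence everywhere
    by uniqueness of product measures; Tonelli then splits the integral. *)
Lemma ge0_integral_pair_law {d d1 d2 : measure_display} {R : realType}
    {Omega : measurableType d} {T1 : measurableType d1} {T2 : measurableType d2}
    (nu : {measure set Omega -> \bar R})
    (m1 : {sigma_finite_measure set T1 -> \bar R})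
    (m2 : {sigma_finite_measure set T2 -> \bar R})
    (V : Omega -> T1) (W : Omega -> T2) (f : T1 * T2 -> \bar R) :
  measurable_fun setT V -> measurable_fun setT W ->
  (forall A B, measurable A -> measurable B ->
    nu (V @^-1` A `&` W @^-1` B) = m1 A * m2 B)%E ->
  measurable_fun setT f -> (forall z, 0 <= f z)%E ->
  (\int[nu]_w f (V w, W w) = \int[m1]_x \int[m2]_y f (x, y))%E.
Proof.
move=> mV mW VW mf f0; have mVW := measurable_fun_pair mV mW.
pose VWf : {mfun Omega >-> (T1 * T2)%type} :=
  HB.pack (fun w => (V w, W w)) (isMeasurableFun.Build _ _ _ _ _ mVW).
transitivity (\int[pushforward nu VWf]_z f z)%E.
  rewrite (ge0_integral_pushforward mVW)//.
transitivity (\int[m1 \x m2]_z f z)%E.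
  apply: eq_measure_integral => E mE _; apply/esym.
  by apply: product_measure_unique => // A B mA mB; rewrite -VW.
exact: fubini_tonelli1.
Qed.

Section joint_law.
Context {d dT : measure_display} {R : realType}.
Context {Omega : measurableType d} {T : measurableType dT}.
Implicit Type Q : probability T R.
Local Open Scope ereal_scope.

(** The factor [c] allows [nu] to be a probability restricted to an event of mass [c]. For [c]
    nonzero, rescaling by its inverse reduces to uniqueness of the product measure; for [c = 0] the
    measure [nu] vanishes, the whole space being the preimage of a rectangle. *)
Lemma pair_law_unique (nu : {measure set Omega -> \bar R}) Q
    (V W : Omega -> T) (c : R) :
  measurable_fun setT V -> measurable_fun setT W -> (0 <= c)%R ->
  (forall A B, measurable A -> measurable B ->
    nu (V @^-1` A `&` W @^-1` B) = c%:E * (Q A * Q B)) ->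
  forall E, measurable E ->
    nu ((fun w => (V w, W w)) @^-1` E) = c%:E * (Q \x Q) E.
Proof.
move=> mV mW c0 VW E mE.
have mVW := measurable_fun_pair mV mW.
pose VWf : {mfun Omega >-> (T * T)%type} :=
  HB.pack (fun w => (V w, W w)) (isMeasurableFun.Build _ _ _ _ _ mVW).
have [c_eq0|c_neq0] := eqVneq c 0%R.
  rewrite c_eq0 mul0e; apply/eqP; rewrite eq_le measure_ge0 andbT.
  have <- : nu setT = 0.
    rewrite -(setIT setT) -[X in X `&` _](preimage_setT V).
    rewrite -[X in _ `&` X](preimage_setT W).
    by rewrite VW// c_eq0 mul0e.
  apply: le_measure => //; rewrite inE//.
  exact: (measurable_preimageT mVW).
have cV0 : (0 <= c^-1)%R by rewrite invr_ge0.
rewrite (@product_measure_unique _ _ _ _ _ Q Q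
  (mscale (NngNum cV0) (pushforward nu VWf)))//=; last first.
  move=> A B mA mB; rewrite /mscale /pushforward /=.
  transitivity ((c^-1)%:E * nu (V @^-1` A `&` W @^-1` B)) => //.
  by rewrite VW// muleA -EFinM mulVf// mul1e.
by rewrite /mscale /pushforward /= muleA -EFinM mulfV// mul1e.
Qed.

Context (P : probability Omega R) (Z : nat -> Omega -> T) (Q : probability T R).
Hypothesis mZ : forall i, measurable_fun setT (Z i).
Hypothesis indepZ : independent_family P Z.
Hypothesis lawZ : forall i A, measurable A -> P (Z i @^-1` A) = Q A.

Let mpair i j : measurable_fun setT (fun w => (Z i w, Z j w)).
Proof. exact: measurable_fun_pair. Qed.

Lemma four_independent i j k l A B C D : uniq [:: i; j; k; l] ->
  measurable A -> measurable B -> measurable C -> measurable D ->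
  P ((Z i @^-1` A `&` Z j @^-1` B) `&` (Z k @^-1` C `&` Z l @^-1` D)) =
  Q A * Q B * (Q C * Q D).
Proof.
move=> uijkl mA mB mC mD.
(* Independence takes one set-valued function on indices; the last branch [D] is meant for [l], and
   no index outside the four is inspected. *)
pose F n := if n == i then A else if n == j then B else if n == k then C else D.
move: (uijkl); rewrite /= !inE !negb_or andbT.
case/and3P => /and3P[ij ik il] /andP[jk jl] kl.
have Fi : F i = A by rewrite /F eqxx.
have Fj : F j = B by rewrite /F eq_sym (negbTE ij) eqxx.
have Fk : F k = C.
  by rewrite /F !(eq_sym k) (negbTE ik) (negbTE jk) eqxx.
have Fl : F l = D.
  by rewrite /F !(eq_sym l) (negbTE il) (negbTE jl) (negbTE kl).
have kNl : k \notin [fset l]%fset by rewrite inE kl.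
have jNkl : j \notin [fset k; l]%fset by rewrite !inE negb_or jk jl.
have iNjkl : i \notin (j |` [fset k; l])%fset by rewrite !inE !negb_or ij ik il.
have := @indepZ (i |` (j |` [fset k; l]))%fset F.
rewrite !big_fsetU1//= big_seq_fset1 Fi Fj Fk Fl !lawZ// -!muleA => <-; last first.
  by move=> n _; rewrite /F; case: ifP => // _; case: ifP => // _; case: ifP.
congr (P _); apply/seteqP; split => w /=.
  move=> [[Ai Bj] [Ck Dl]] n; rewrite /= !inE.
  by move=> /or4P[] /eqP ->; rewrite ?Fi ?Fj ?Fk ?Fl.
move=> H; split; split.
- by have := H i; rewrite /= Fi; apply; rewrite !inE eqxx.
- by have := H j; rewrite /= Fj; apply; rewrite !inE eqxx orbT.
- by have := H k; rewrite /= Fk; apply; rewrite !inE eqxx !orbT.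
- by have := H l; rewrite /= Fl; apply; rewrite !inE eqxx !orbT.
Qed.

(** Rectangles are replaced by arbitrary measurable sets one pair at a time: first [E], for the
    measure restricted to a rectangle event of [(Z k, Z l)], then [F], for the measure restricted to
    the event defined by [E]. *)
Lemma joint_law4 i j k l E F : uniq [:: i; j; k; l] ->
  measurable E -> measurable F ->
  P ((fun w => (Z i w, Z j w)) @^-1` E `&` (fun w => (Z k w, Z l w)) @^-1` F) =
  (Q \x Q) E * (Q \x Q) F.
Proof.
move=> uijkl mE mF.
have mZE := measurable_preimageT (mpair i j) mE.
have QE C D : measurable C -> measurable D ->
    P ((fun w => (Z i w, Z j w)) @^-1` E `&` (Z k @^-1` C `&` Z l @^-1` D)) =
    (Q \x Q) E * (Q C * Q D).
  move=> mC mD.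
  have mCD : measurable (Z k @^-1` C `&` Z l @^-1` D).
    by apply: measurableI; exact: measurable_preimageT.
  have QCD : Q C * Q D \is a fin_num by rewrite fin_numM// fin_num_measure.
  transitivity ((fine (Q C * Q D))%:E * (Q \x Q) E).
    apply: (@pair_law_unique (mrestr P mCD)) => //.
      by rewrite fine_ge0// mule_ge0.
    move=> A B mA mB; transitivity (Q A * Q B * (Q C * Q D)).
      exact: four_independent.
    by rewrite fineK// muleC.
  by rewrite fineK// muleC.
have QEfin : (Q \x Q) E \is a fin_num.
  exact: (fin_num_measure ((Q \x Q) : probability (T * T)%type R)).
transitivity ((fine ((Q \x Q) E))%:E * (Q \x Q) F); last by rewrite fineK.
transitivity (mrestr P mZE ((fun w => (Z k w, Z l w)) @^-1` F)).
  by rewrite /mrestr setIC.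
apply: pair_law_unique => //; first by rewrite fine_ge0.
by move=> A B mA mB; rewrite fineK// -QE// [in RHS]setIC.
Qed.

Lemma ge0_integral_joint4 i j k l (f : (T * T) * (T * T) -> \bar R) :
  uniq [:: i; j; k; l] -> measurable_fun setT f -> (forall z, 0 <= f z) ->
  \int[P]_w f ((Z i w, Z j w), (Z k w, Z l w)) =
  \int[Q]_z1 \int[Q]_z2 \int[Q]_z3 \int[Q]_z4 f ((z1, z2), (z3, z4)).
Proof.
move=> uijkl mf f0; pose Q2 : probability (T * T)%type R := (Q \x Q).
rewrite (@ge0_integral_pair_law _ _ _ _ _ _ _ P Q2 Q2 _ _ f
  (mpair i j) (mpair k l))//; last first.
  by move=> A B mA mB; exact: joint_law4.
transitivity (\int[Q2]_z \int[Q]_z3 \int[Q]_z4 f (z, (z3, z4))).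
  apply: eq_integral => z _; apply: (fubini_tonelli1 (fun z' => f (z, z'))) => //.
  exact: measurableT_comp mf (pair1_measurable _).
apply: (fubini_tonelli1 (fun z => \int[Q]_z3 \int[Q]_z4 f (z, (z3, z4)))).
(* The inner double integral is measurable in [z] because it is the section integral of [f] against
   [Q2]. *)
- rewrite (_ : (fun _ => _) = fubini_F Q2 f).
    exact: measurable_fun_fubini_tonelli_F.
  apply/funext => z; apply/esym.
  apply: (fubini_tonelli1 (fun z' => f (z, z'))) => //.
  exact: measurableT_comp mf (pair1_measurable _).
- by move=> z; apply: integral_ge0 => z3 _; apply: integral_ge0.
Qed.

End joint_law.

(** * Potentials of quasi-metric kernels *)

Section quasi_kernel.
Context {dT : measure_display} {R : realType} {T : measurableType dT}.

(* An abstract version of [k (z, z') = d(x, x') ^ a], where [z = (x, y)], and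
   [u z = d(x, xo) ^ a]; [C] is the constant of the quasi triangle inequality. *)
Record quasi_kernel (C : R) (k : T * T -> R) (u : T -> R) : Prop := {
  qk_measurable : measurable_fun setT k;
  qk_radius_measurable : measurable_fun setT u;
  qk_ge0 : forall p, 0 <= k p;
  qk_radius_ge0 : forall z, 0 <= u z;
  qk_const_ge0 : 0 <= C;
  qk_sym : forall z z', k (z, z') = k (z', z);
  qk_le : forall z z', k (z, z') <= C * (u z + u z');
  qk_radius_le : forall z z', u z <= C * (k (z, z') + u z') }.

Variable Q : probability T R.
Local Open Scope ereal_scope.

Definition potential (k : T * T -> R) (z : T) : \bar R :=
  \int[Q]_z' (k (z, z'))%:E.

Lemma ge0_integralD_EFin (f g : T -> R) :
  measurable_fun setT f -> measurable_fun setT g ->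
  (forall z, 0 <= f z)%R -> (forall z, 0 <= g z)%R ->
  \int[Q]_z (f z + g z)%:E = \int[Q]_z (f z)%:E + \int[Q]_z (g z)%:E.
Proof.
move=> mf mg f0 g0; under eq_integral do rewrite EFinD.
by apply: ge0_integralD => //; try exact/measurable_EFinP;
  move=> z _; rewrite lee_fin.
Qed.

Lemma ge0_integralZl_real (c : R) (f : T -> R) :
  measurable_fun setT f -> (0 <= c)%R -> (forall z, 0 <= f z)%R ->
  \int[Q]_z (c * f z)%:E = c%:E * \int[Q]_z (f z)%:E.
Proof.
move=> mf c0 f0; under eq_integral do rewrite EFinM.
apply: ge0_integralZl_EFin => //; last exact/measurable_EFinP.
by move=> z _; rewrite lee_fin.
Qed.

Lemma integral_cst_probability (c : \bar R) : \int[Q]_z c = c.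
Proof. by rewrite integral_cst//= probability_setT mule1. Qed.

Lemma ge0_integral_le_fin (f g : T -> \bar R) :
  measurable_fun setT f -> measurable_fun setT g ->
  (forall z, 0 <= f z <= g z) -> \int[Q]_z g z < +oo -> \int[Q]_z f z < +oo.
Proof.
move=> mf mg fg; apply: le_lt_trans; apply: ge0_le_integral => //.
- by move=> z _; have /andP[] := fg z.
- by move=> z _; have /andP[] := fg z.
Qed.

Lemma ge0_integral_eq0 (f : T -> \bar R) : measurable_fun setT f ->
  (forall z, 0 <= f z) -> \int[Q]_z f z = 0 -> {ae Q, forall z, f z = 0}.
Proof.
move=> mf f0 If; have : \int[Q]_z `|f z| = 0.
  by under eq_integral do rewrite gee0_abs//.
move/(ae_eq_integral_abs Q measurableT mf).
by apply: filterS => z /= ->.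
Qed.

Lemma integral_gt0_probability (f : T -> \bar R) : measurable_fun setT f ->
  (forall z, 0 < f z) -> 0 < \int[Q]_z f z.
Proof.
move=> mf f0; rewrite lt_neqAle integral_ge0 ?andbT; last by move=> z _; exact: ltW.
apply/eqP => /esym/(ge0_integral_eq0 mf (fun z => ltW (f0 z))).
move/negligibleP; rewrite (_ : ~` _ = setT).
  move=> /(_ measurableT) Q0.
  by have /eqP := etrans (esym Q0) (probability_setT Q); rewrite eqe eq_sym oner_eq0.
by apply/seteqP; split => // z _ /= fz; have := f0 z; rewrite fz ltxx.
Qed.

Section potential_kernel.
Variables (k : T * T -> R).
Hypotheses (mk : measurable_fun setT k) (k0 : forall p, (0 <= k p)%R).

Lemma measurable_section_kernel z : measurable_fun setT (fun z' => k (z, z')).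
Proof. exact: (measurableT_comp mk (pair1_measurable z)). Qed.

Lemma potential_ge0 z : 0 <= potential k z.
Proof. by apply: integral_ge0 => z' _; rewrite lee_fin. Qed.

Lemma measurable_potential : measurable_fun setT (potential k).
Proof.
apply: (measurable_fun_fubini_tonelli_F (EFin \o k)) => //=.
exact/measurable_EFinP.
Qed.

End potential_kernel.

Section one_kernel.
Variables (C : R) (k : T * T -> R) (u : T -> R).
Hypothesis qk : quasi_kernel C k u.
Let mk := qk_measurable qk.
Let k0 := qk_ge0 qk.
Let mu := qk_radius_measurable qk.
Let u0 := qk_radius_ge0 qk.
Let C0 := qk_const_ge0 qk.
Let mkz := measurable_section_kernel mk.

(** Integrates [u z' <= C * (k (z, z') + u z)] over [z']; the two bounds [potential_le] and
    [radius_le] integrate the other inequalities of [quasi_kernel] in the same way. *)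
Lemma integral_radius_le z :
  \int[Q]_z' (u z')%:E <= C%:E * (potential k z + (u z)%:E).
Proof.
have -> : C%:E * (potential k z + (u z)%:E) =
    \int[Q]_z' (C * (k (z, z') + u z))%:E.
  rewrite ge0_integralZl_real//; last 2 first.
  - exact: measurable_funD.
  - by move=> z'; rewrite addr_ge0.
  by rewrite ge0_integralD_EFin// integral_cst_probability.
apply: ge0_le_integral => //.
- by move=> z' _; rewrite lee_fin.
- exact/measurable_EFinP.
- by apply/measurable_EFinP; apply: measurable_funM => //; exact: measurable_funD.
- by move=> z' _; rewrite lee_fin (qk_sym qk); exact: qk_radius_le.
Qed.

(** Since [u z] is a finite real, the infinite left side of [integral_radius_le] can only come from
    the potential, whatever the point [z]. *)
Lemma potential_eqy : \int[Q]_z (u z)%:E = +oo -> forall z, potential k z = +oo.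
Proof.
move=> uy z; have := integral_radius_le z; rewrite uy leye_eq => /eqP.
by have := potential_ge0 k0 z; case: (potential k z).
Qed.

Lemma potential_le z :
  potential k z <= C%:E * ((u z)%:E + \int[Q]_z' (u z')%:E).
Proof.
have -> : C%:E * ((u z)%:E + \int[Q]_z' (u z')%:E) =
    \int[Q]_z' (C * (u z + u z'))%:E.
  rewrite ge0_integralZl_real//; last 2 first.
  - exact: measurable_funD.
  - by move=> z'; rewrite addr_ge0.
  by rewrite ge0_integralD_EFin// integral_cst_probability.
apply: ge0_le_integral => //.
- by move=> z' _; rewrite lee_fin.
- exact/measurable_EFinP.
- by apply/measurable_EFinP; apply: measurable_funM => //; exact: measurable_funD.
- by move=> z' _; rewrite lee_fin; exact: qk_le.
Qed.

Lemma radius_le z : (u z)%:E <= C%:E * (potential k z + \int[Q]_z' (u z')%:E).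
Proof.
have -> : C%:E * (potential k z + \int[Q]_z' (u z')%:E) =
    \int[Q]_z' (C * (k (z, z') + u z'))%:E.
  rewrite ge0_integralZl_real//; last 2 first.
  - exact: measurable_funD.
  - by move=> z'; rewrite addr_ge0.
  by rewrite ge0_integralD_EFin.
rewrite -[leLHS]integral_cst_probability; apply: ge0_le_integral => //.
- by move=> z' _; rewrite lee_fin.
- by apply/measurable_EFinP; apply: measurable_funM => //; exact: measurable_funD.
- by move=> z' _; rewrite lee_fin; exact: qk_radius_le.
Qed.

Hypothesis u_fin : \int[Q]_z (u z)%:E < +oo.

Lemma radius_fin_num : \int[Q]_z (u z)%:E \is a fin_num.
Proof. by rewrite ge0_fin_numE//; apply: integral_ge0 => z _; rewrite lee_fin. Qed.

Lemma potential_fin_num z : potential k z \is a fin_num.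
Proof.
rewrite ge0_fin_numE ?potential_ge0//; apply: le_lt_trans (potential_le z) _.
by rewrite -(fineK radius_fin_num) -EFinD -EFinM ltry.
Qed.

Lemma integral_potential_fin : \int[Q]_z potential k z < +oo.
Proof.
apply: (@ge0_integral_le_fin _
    (fun z => (C * (u z + fine (\int[Q]_z (u z)%:E)))%:E)).
- exact: measurable_potential.
- by apply/measurable_EFinP; apply: measurable_funM => //; exact: measurable_funD.
- move=> z; rewrite potential_ge0//= EFinM EFinD (fineK radius_fin_num).
  exact: potential_le.
- have U0 : (0 <= fine (\int[Q]_z (u z)%:E))%R.
    by rewrite fine_ge0//; apply: integral_ge0 => z _; rewrite lee_fin.
  rewrite ge0_integralZl_real//; last 2 first.
  + exact: measurable_funD.
  + by move=> z'; rewrite addr_ge0.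
  rewrite ge0_integralD_EFin// integral_cst_probability.
  by rewrite fineK ?radius_fin_num// -(fineK radius_fin_num) -EFinD -EFinM ltry.
Qed.

End one_kernel.

(** Four terms, because every use expands a product of two bounds of the form [C * (s + t)]. *)
Lemma ge0_integral_lty4 (c : R) (f : T -> \bar R) (f1 f2 f3 f4 : T -> R) :
  (0 <= c)%R -> measurable_fun setT f ->
  measurable_fun setT f1 -> measurable_fun setT f2 ->
  measurable_fun setT f3 -> measurable_fun setT f4 ->
  (forall z, 0 <= f1 z)%R -> (forall z, 0 <= f2 z)%R ->
  (forall z, 0 <= f3 z)%R -> (forall z, 0 <= f4 z)%R ->
  (forall z, 0 <= f z <= (c * (f1 z + f2 z + f3 z + f4 z))%:E) ->
  \int[Q]_z (f1 z)%:E < +oo -> \int[Q]_z (f2 z)%:E < +oo ->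
  \int[Q]_z (f3 z)%:E < +oo -> \int[Q]_z (f4 z)%:E < +oo ->
  \int[Q]_z f z < +oo.
Proof.
move=> c0 mf m1 m2 m3 m4 p1 p2 p3 p4 ff I1 I2 I3 I4.
have m12 : measurable_fun setT (fun z => f1 z + f2 z)%R by exact: measurable_funD.
have m123 : measurable_fun setT (fun z => f1 z + f2 z + f3 z)%R.
  exact: measurable_funD.
have m1234 : measurable_fun setT (fun z => f1 z + f2 z + f3 z + f4 z)%R.
  exact: measurable_funD.
apply: (ge0_integral_le_fin mf _ ff).
  by apply/measurable_EFinP; apply: measurable_funM.
rewrite ge0_integralZl_real//; last by move=> z; rewrite !addr_ge0.
rewrite !ge0_integralD_EFin//; try by move=> z; rewrite !addr_ge0.
by rewrite lte_mul_pinfty// ?lee_fin//; do 3!apply: lte_add_pinfty => //.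
Qed.

(** * Finiteness of the three cross integrals compared with finiteness of the moments *)

Section two_kernels.
Variables (C : R) (k l : T * T -> R) (u v : T -> R).
Hypotheses (qku : quasi_kernel C k u) (qlv : quasi_kernel C l v).
Let mk := qk_measurable qku.
Let ml := qk_measurable qlv.
Let mu := qk_radius_measurable qku.
Let mv := qk_radius_measurable qlv.
Let k0 := qk_ge0 qku.
Let l0 := qk_ge0 qlv.
Let u0 := qk_radius_ge0 qku.
Let v0 := qk_radius_ge0 qlv.
Let C0 := qk_const_ge0 qku.
Let mkl : measurable_fun setT (fun p => k p * l p)%R.
Proof. exact: measurable_funM. Qed.
Let muv : measurable_fun setT (fun z => u z * v z)%R.
Proof. exact: measurable_funM. Qed.
Let CC0 : (0 <= C * C)%R. Proof. exact: mulr_ge0. Qed.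

Let U := \int[Q]_z (u z)%:E.
Let V := \int[Q]_z (v z)%:E.
Let W := \int[Q]_z (u z * v z)%:E.
(** [cross1], [cross2], [cross3] are E_1, E_2, E_3 written as extended-real integrals against the
    law [Q]. *)
Definition cross1 := \int[Q]_z \int[Q]_z' (k (z, z') * l (z, z'))%:E.
Definition cross2 := (\int[Q]_z potential k z) * (\int[Q]_z potential l z).
Definition cross3 := \int[Q]_z (potential k z * potential l z).

Let U0 : 0 <= U. Proof. by apply: integral_ge0 => z _; rewrite lee_fin. Qed.
Let V0 : 0 <= V. Proof. by apply: integral_ge0 => z _; rewrite lee_fin. Qed.
Let W0 : 0 <= W.
Proof. by apply: integral_ge0 => z _; rewrite lee_fin mulr_ge0. Qed.

Let mfine (h : T * T -> R) : measurable_fun setT h -> (forall p, 0 <= h p)%R ->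
  measurable_fun setT (fun z => fine (potential h z)).
Proof.
move=> mh h0.
exact: (measurableT_comp (fine_measurable measurableT)
  (measurable_potential mh h0)).
Qed.

Let fine0 (h : T * T -> R) z : (forall p, 0 <= h p)%R ->
  (0 <= fine (potential h z))%R.
Proof. by move=> h0; rewrite fine_ge0// potential_ge0. Qed.

(** Multiplying the [radius_le] bounds for [u] and [v] gives the product of the potentials,
    integrable by assumption, two single potentials with finite coefficients, and a constant. *)
Lemma cross3_lty_moment : U < +oo -> V < +oo -> cross3 < +oo -> W < +oo.
Proof.
move=> Uy Vy I3.
have Ufin : U \is a fin_num := radius_fin_num qku Uy.
have Vfin : V \is a fin_num := radius_fin_num qlv Vy.
have phiE z := fineK (potential_fin_num qku Uy z).
have lamE z := fineK (potential_fin_num qlv Vy z).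
have fU0 : (0 <= fine U)%R by rewrite fine_ge0.
have fV0 : (0 <= fine V)%R by rewrite fine_ge0.
have mphi := mfine mk k0; have mlam := mfine ml l0.
apply: (@ge0_integral_lty4 (C * C) _
  (fun z => fine (potential k z) * fine (potential l z))%R
  (fun z => fine V * fine (potential k z))%R
  (fun z => fine U * fine (potential l z))%R
  (fun=> fine U * fine V)%R) => //.
- exact/measurable_EFinP.
- exact: measurable_funM.
- exact: measurable_funM.
- exact: measurable_funM.
- by move=> z; rewrite mulr_ge0// fine0.
- by move=> z; rewrite mulr_ge0// fine0.
- by move=> z; rewrite mulr_ge0// fine0.
- by move=> z; rewrite mulr_ge0.
- move=> z; rewrite !lee_fin mulr_ge0//=.
  have uz : (u z <= C * (fine (potential k z) + fine U))%R.
    by rewrite -lee_fin EFinM EFinD phiE (fineK Ufin); exact: (radius_le qku).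
  have vz : (v z <= C * (fine (potential l z) + fine V))%R.
    by rewrite -lee_fin EFinM EFinD lamE (fineK Vfin); exact: (radius_le qlv).
  apply: le_trans (ler_pM (u0 z) (v0 z) uz vz) _.
  by rewrite le_eqVlt; apply/orP; left; apply/eqP; ring.
- by under eq_integral do rewrite EFinM phiE lamE.
- rewrite ge0_integralZl_real//; last by move=> z; exact: fine0.
  under eq_integral do rewrite phiE.
  by rewrite lte_mul_pinfty// ?lee_fin//; exact: (integral_potential_fin qku).
- rewrite ge0_integralZl_real//; last by move=> z; exact: fine0.
  under eq_integral do rewrite lamE.
  by rewrite lte_mul_pinfty// ?lee_fin//; exact: (integral_potential_fin qlv).
- by rewrite integral_cst_probability ltry.
Qed.

Let mg : measurable_fun setT (fun z => \int[Q]_z' (k (z, z') * l (z, z'))%:E).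
Proof.
apply: (@measurable_potential (fun p => k p * l p)%R) => //.
by move=> p; exact: mulr_ge0.
Qed.

(** At a point [z0] where the inner integral is finite, the radius inequalities between [z] and [z0]
    bound [u z * v z] by four functions of [z] that are all integrable, [z0] being frozen. *)
Lemma cross1_lty_moment : U < +oo -> V < +oo -> cross1 < +oo -> W < +oo.
Proof.
move=> Uy Vy I1.
have phiE z := fineK (potential_fin_num qku Uy z).
have lamE z := fineK (potential_fin_num qlv Vy z).
(* If the inner integral were infinite at every point, [cross1] would be the integral of the
   constant [+oo] against a probability. *)
have [z0 gz0] : exists z, \int[Q]_z' (k (z, z') * l (z, z'))%:E < +oo.
  apply: contrapT => /forallNP H; move: I1; rewrite /cross1.
  rewrite (eq_integral (cst +oo)) ?integral_cst_probability ?ltxx//.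
  by move=> z _; apply/eqP; rewrite -leye_eq leNgt; apply/negP; exact: H.
have mkz := measurable_section_kernel mk z0.
have mlz := measurable_section_kernel ml z0.
apply: (@ge0_integral_lty4 (C * C) _
  (fun z' => k (z0, z') * l (z0, z'))%R
  (fun z' => v z0 * k (z0, z'))%R
  (fun z' => u z0 * l (z0, z'))%R
  (fun=> u z0 * v z0)%R) => //.
- exact/measurable_EFinP.
- exact: measurable_funM.
- exact: measurable_funM.
- exact: measurable_funM.
- by move=> z; rewrite mulr_ge0.
- by move=> z; rewrite mulr_ge0.
- by move=> z; rewrite mulr_ge0.
- by move=> z; rewrite mulr_ge0.
- move=> z; rewrite !lee_fin mulr_ge0//=.
  have uz := qk_radius_le qku z z0; have vz := qk_radius_le qlv z z0.
  apply: le_trans (ler_pM (u0 z) (v0 z) uz vz) _.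
  rewrite (qk_sym qku) (qk_sym qlv).
  by rewrite le_eqVlt; apply/orP; left; apply/eqP; ring.
- rewrite ge0_integralZl_real// -[X in _ * X]/(potential k z0) -phiE -EFinM.
  exact: ltry.
- rewrite ge0_integralZl_real// -[X in _ * X]/(potential l z0) -lamE -EFinM.
  exact: ltry.
- by rewrite integral_cst_probability ltry.
Qed.

(** For [cross1] and [cross3] the upper bounds of [k] and [l], respectively of their potentials, are
    multiplied out; each resulting term is controlled by [U], [V] or [W]. *)
Lemma cross_lty : U < +oo -> V < +oo -> W < +oo ->
  [/\ cross1 < +oo, \int[Q]_z potential k z < +oo,
      \int[Q]_z potential l z < +oo & cross3 < +oo].
Proof.
move=> Uy Vy Wy.
have Ufin : U \is a fin_num := radius_fin_num qku Uy.
have Vfin : V \is a fin_num := radius_fin_num qlv Vy.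
have Wfin : W \is a fin_num by rewrite ge0_fin_numE.
have fU0 : (0 <= fine U)%R by rewrite fine_ge0.
have fV0 : (0 <= fine V)%R by rewrite fine_ge0.
have fW0 : (0 <= fine W)%R by rewrite fine_ge0.
split.
- apply: (@ge0_integral_lty4 (C * C) _ (fun z => u z * v z)%R
    (fun z => fine V * u z)%R (fun z => fine U * v z)%R (fun=> fine W)%R) => //.
  + exact: measurable_funM.
  + exact: measurable_funM.
  + by move=> z; rewrite mulr_ge0.
  + by move=> z; rewrite mulr_ge0.
  + by move=> z; rewrite mulr_ge0.
  + move=> z; apply/andP; split.
      by apply: integral_ge0 => z' _; rewrite lee_fin mulr_ge0.
    (* Integration over [z'] at fixed [z] turns [v z'], [u z'] and [u z' * v z'] into [V], [U] and
       [W], so the right side is the integrated pointwise bound on [k * l]. *)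
    have -> : (C * C * (u z * v z + fine V * u z + fine U * v z + fine W))%:E =
        \int[Q]_z' (C * C * (u z * v z + u z * v z' + v z * u z' + u z' * v z'))%:E.
      have p1 z' : (0 <= u z * v z + u z * v z')%R by rewrite addr_ge0// mulr_ge0.
      have p2 z' : (0 <= u z * v z + u z * v z' + v z * u z')%R.
        by rewrite addr_ge0// mulr_ge0.
      have p3 z' : (0 <= u z' * v z')%R by rewrite mulr_ge0.
      have m1 : measurable_fun setT (fun z' => u z * v z')%R.
        exact: measurable_funM.
      have m2 : measurable_fun setT (fun z' => v z * u z')%R.
        exact: measurable_funM.
      have m3 : measurable_fun setT (fun z' => u z * v z + u z * v z')%R.
        exact: measurable_funD.
      have m4 : measurable_fun setT
          (fun z' => u z * v z + u z * v z' + v z * u z')%R.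
        exact: measurable_funD.
      rewrite ge0_integralZl_real//; last 2 first.
      - exact: measurable_funD.
      - by move=> z'; rewrite addr_ge0.
      rewrite !ge0_integralD_EFin//; try by move=> z'; rewrite mulr_ge0.
      rewrite integral_cst_probability !ge0_integralZl_real//.
      rewrite -/U -/V -/W.
      rewrite -[in RHS](fineK Ufin) -[in RHS](fineK Vfin) -[in RHS](fineK Wfin).
      rewrite [LHS]EFinM; congr (_ * _); rewrite !EFinD !EFinM.
      by rewrite (muleC (fine V)%:E) (muleC (fine U)%:E).
    apply: ge0_le_integral => //.
    * by move=> z' _; rewrite lee_fin mulr_ge0.
    * by apply/measurable_EFinP; exact: (measurable_section_kernel mkl).
    * apply/measurable_EFinP; apply: measurable_funM => //.
      do 3?[apply: measurable_funD => //]; exact: measurable_funM.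
    * move=> z' _; rewrite lee_fin.
      apply: le_trans (ler_pM (k0 _) (l0 _) (qk_le qku z z') (qk_le qlv z z')) _.
      by rewrite le_eqVlt; apply/orP; left; apply/eqP; ring.
  + rewrite ge0_integralZl_real// -/U lte_mul_pinfty// ?lee_fin//.
  + rewrite ge0_integralZl_real// -/V lte_mul_pinfty// ?lee_fin//.
  + by rewrite integral_cst_probability ltry.
- exact: (integral_potential_fin qku).
- exact: (integral_potential_fin qlv).
- have phiE z := fineK (potential_fin_num qku Uy z).
  have lamE z := fineK (potential_fin_num qlv Vy z).
  apply: (@ge0_integral_lty4 (C * C) _ (fun z => u z * v z)%R
    (fun z => fine V * u z)%R (fun z => fine U * v z)%R
    (fun=> fine U * fine V)%R) => //.
  + by apply: emeasurable_funM; exact: measurable_potential.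
  + exact: measurable_funM.
  + exact: measurable_funM.
  + by move=> z; rewrite mulr_ge0.
  + by move=> z; rewrite mulr_ge0.
  + by move=> z; rewrite mulr_ge0.
  + by move=> z; rewrite mulr_ge0.
  + move=> z; rewrite mule_ge0 ?potential_ge0//= -phiE -lamE -EFinM lee_fin.
    have uz : (fine (potential k z) <= C * (u z + fine U))%R.
      by rewrite -lee_fin EFinM EFinD phiE (fineK Ufin); exact: (potential_le qku).
    have vz : (fine (potential l z) <= C * (v z + fine V))%R.
      by rewrite -lee_fin EFinM EFinD lamE (fineK Vfin); exact: (potential_le qlv).
    apply: le_trans (ler_pM (fine0 z k0) (fine0 z l0) uz vz) _.
    by rewrite le_eqVlt; apply/orP; left; apply/eqP; ring.
  + rewrite ge0_integralZl_real// -/U lte_mul_pinfty// ?lee_fin//.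
  + rewrite ge0_integralZl_real// -/V lte_mul_pinfty// ?lee_fin//.
  + by rewrite integral_cst_probability ltry.
Qed.

Lemma cross_eqy : U + V + W = +oo ->
  (forall z, 0 < potential k z) -> (forall z, 0 < potential l z) ->
  cross1 + cross2 = +oo /\ cross3 = +oo.
Proof.
move=> UVW phi0 lam0.
have cross1_ge0 : 0 <= cross1.
  apply: integral_ge0 => z _; apply: integral_ge0 => z' _.
  by rewrite lee_fin mulr_ge0.
have cross3_ge0 : 0 <= cross3.
  by apply: integral_ge0 => z _; rewrite mule_ge0 ?potential_ge0.
have pos (h : T * T -> R) : measurable_fun setT h -> (forall p, 0 <= h p)%R ->
    (forall z, 0 < potential h z) -> 0 < \int[Q]_z potential h z.
  by move=> mh h0; apply: integral_gt0_probability; exact: measurable_potential.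
(* An infinite [U] makes the potential of [k] infinite everywhere. Strict positivity of the
   potential of [l], and of its integral, keeps [cross3] and [cross2] away from the product
   [+oo * 0], which is 0 by convention. *)
have [Uy|Uy] := eqVneq U +oo.
  have phiy := potential_eqy qku Uy.
  have I2 : cross2 = +oo.
    rewrite /cross2; under eq_integral do rewrite phiy.
    by rewrite integral_cst_probability gt0_mulye// pos.
  split; first by rewrite I2 addey// gt_eqF// (lt_le_trans _ cross1_ge0).
  rewrite /cross3; under eq_integral do rewrite phiy gt0_mulye//.
  exact: integral_cst_probability.
have [Vy|Vy] := eqVneq V +oo.
  have lamy := potential_eqy qlv Vy.
  have I2 : cross2 = +oo.
    rewrite /cross2; under [X in _ * X]eq_integral do rewrite lamy.
    by rewrite integral_cst_probability gt0_muley// pos.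
  split; first by rewrite I2 addey// gt_eqF// (lt_le_trans _ cross1_ge0).
  rewrite /cross3; under eq_integral do rewrite lamy gt0_muley//.
  exact: integral_cst_probability.
(* With [U] and [V] finite, only [W] can be infinite, and the two moment lemmas apply by
   contraposition. *)
rewrite -!ltey in Uy Vy.
have Wy : ~~ (W < +oo).
  apply/negP => Wy; have : U + V + W < +oo by do 2!apply: lte_add_pinfty => //.
  by rewrite UVW ltxx.
have I1 : cross1 = +oo.
  by apply/eqP; rewrite -leye_eq leNgt; apply: contra Wy; exact: cross1_lty_moment.
have I3 : cross3 = +oo.
  by apply/eqP; rewrite -leye_eq leNgt; apply: contra Wy; exact: cross3_lty_moment.
split=> //; rewrite I1 addye// gt_eqF// (lt_le_trans ltNy0)//.
by rewrite /cross2 mule_ge0// integral_ge0// => z _; exact: potential_ge0.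
Qed.

End two_kernels.

End quasi_kernel.

(** * Expectations of products of alternating sums *)

Section alternating_sums.
Context {d : measure_display} {R : realType} {Omega : measurableType d}.
Variable P : probability Omega R.

(** The common shape of the hat sum and of its conditional expectation; written out rather than as a
    sum so that [hat] is an instance by conversion. *)
Definition alt4 (f : nat -> Omega -> R) (w : Omega) : R :=
  f 0%N w - f 1%N w + f 2%N w - f 3%N w.

Local Open Scope ereal_scope.

(** The domain [D] stays general: the whole space serves for expectations of products, an event of
    the conditioning sigma-algebra for conditional expectations. *)
Lemma integral_lincomb (I : finType) (D : set Omega) (s : I -> R)
    (F : I -> Omega -> R) : measurable D ->
  (forall i, P.-integrable setT (EFin \o F i)) ->
  P.-integrable setT (fun w => (\sum_i s i * F i w)%:E) /\
  \int[P]_(w in D) (\sum_i s i * F i w)%:E =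
  \sum_i (s i)%:E * \int[P]_(w in D) (F i w)%:E.
Proof.
move=> mD iF.
have isF i : P.-integrable setT (fun w => (s i)%:E * (F i w)%:E).
  exact: integrableZl (iF i).
have eqF : (fun w => (\sum_i s i * F i w)%:E) =
    (fun w => \sum_(i <- index_enum I) (s i)%:E * (F i w)%:E).
  by apply/funext => w; rewrite -sumEFin; apply: eq_bigr => i _; rewrite EFinM.
rewrite eqF; split; first exact: integrable_sum.
rewrite integral_sum//; last by move=> i; exact: integrableS (isF i).
apply: eq_bigr => i _; rewrite integralZl//.
exact: integrableS (iF i).
Qed.

Lemma alt4E (f : nat -> Omega -> R) w :
  alt4 f w = (\sum_(i < 4) (-1) ^+ i * f i w)%R.
Proof. by rewrite /alt4 !big_ord_recl big_ord0 /= /bump /=; ring. Qed.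

Lemma alt4_mulE (f g : nat -> Omega -> R) w : (alt4 f w * alt4 g w =
  \sum_(p : 'I_4 * 'I_4) (-1) ^+ (p.1 + p.2) * (f p.1 w * g p.2 w))%R.
Proof.
rewrite -(pair_bigA _ (fun i j : 'I_4 => (-1) ^+ (i + j) * (f i w * g j w))%R)/=.
rewrite !alt4E big_distrl/=; apply: eq_bigr => i _.
rewrite big_distrr/=; apply: eq_bigr => j _; rewrite exprD; ring.
Qed.

Lemma integrable_ge0_fin (f : Omega -> R) : measurable_fun setT f ->
  (forall w, 0 <= f w)%R -> \int[P]_w (f w)%:E < +oo ->
  P.-integrable setT (EFin \o f).
Proof.
move=> mf f0 foo; apply/integrableP; split; first exact/measurable_EFinP.
by under eq_integral do rewrite /= ger0_norm//.
Qed.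

Lemma integrable_alt4 (f : nat -> Omega -> R) :
  (forall i, (i < 4)%N -> P.-integrable setT (EFin \o f i)) ->
  P.-integrable setT (EFin \o alt4 f).
Proof.
move=> If.
have [+ _] := @integral_lincomb _ setT (fun i : 'I_4 => (-1) ^+ i)%R
  (fun i : 'I_4 => f i) measurableT (fun i => If i (ltn_ord i)).
by apply: eq_integrable => // w _; rewrite /= alt4E.
Qed.

Lemma eq_integral_alt4 (f g : nat -> Omega -> R) D : measurable D ->
  (forall i, (i < 4)%N -> P.-integrable setT (EFin \o f i)) ->
  (forall i, (i < 4)%N -> P.-integrable setT (EFin \o g i)) ->
  (forall i, (i < 4)%N ->
    \int[P]_(w in D) (f i w)%:E = \int[P]_(w in D) (g i w)%:E) ->
  \int[P]_(w in D) (alt4 f w)%:E = \int[P]_(w in D) (alt4 g w)%:E.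
Proof.
move=> mD If Ig fg.
under eq_integral do rewrite alt4E.
under [RHS]eq_integral do rewrite alt4E.
have [_ ->] := @integral_lincomb _ D (fun i : 'I_4 => (-1) ^+ i)%R
  (fun i : 'I_4 => f i) mD (fun i => If i (ltn_ord i)).
have [_ ->] := @integral_lincomb _ D (fun i : 'I_4 => (-1) ^+ i)%R
  (fun i : 'I_4 => g i) mD (fun i => Ig i (ltn_ord i)).
by apply: eq_bigr => i _; rewrite fg.
Qed.

(** [e] is the table of the sixteen expectations. Because the terms are nonnegative, a real value of
    each expectation already yields integrability. *)
Lemma integral_alt4_mul (f g : nat -> Omega -> R) (e : nat -> nat -> R) :
  (forall i, (i < 4)%N -> measurable_fun setT (f i)) ->
  (forall i, (i < 4)%N -> measurable_fun setT (g i)) ->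
  (forall i w, (i < 4)%N -> 0 <= f i w)%R ->
  (forall i w, (i < 4)%N -> 0 <= g i w)%R ->
  (forall i j, (i < 4)%N -> (j < 4)%N ->
    \int[P]_w (f i w * g j w)%:E = (e i j)%:E) ->
  P.-integrable setT (fun w => (alt4 f w * alt4 g w)%:E) /\
  \int[P]_w (alt4 f w * alt4 g w)%:E =
    (\sum_(i < 4) \sum_(j < 4) (-1) ^+ (i + j) * e i j)%:E.
Proof.
move=> mf mg f0 g0 fge.
have Ifg (p : 'I_4 * 'I_4) :
    P.-integrable setT (EFin \o (fun w => f p.1 w * g p.2 w)%R).
  apply: integrable_ge0_fin.
  - by apply: measurable_funM; [exact: mf|exact: mg].
  - by move=> w; rewrite mulr_ge0 ?f0 ?g0.
  - by rewrite fge// ltry.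
have [I1 I2] := @integral_lincomb _ setT
  (fun p : 'I_4 * 'I_4 => (-1) ^+ (p.1 + p.2))%R _ measurableT Ifg.
split; first by apply: eq_integrable I1 => // w _; rewrite /= alt4_mulE.
under eq_integral do rewrite alt4_mulE.
rewrite I2 pair_bigA/= -sumEFin; apply: eq_bigr => p _.
by rewrite fge// EFinM.
Qed.

End alternating_sums.

(** * Expectations of kernels evaluated at independent copies *)

Section conditioning.
Context {d dT : measure_display} {R : realType}.
Context {Omega : measurableType d} {T : measurableType dT}.
Context (P : probability Omega R) (Z : nat -> Omega -> T) (Q : probability T R).
Hypothesis mZ : forall i, measurable_fun setT (Z i).
Hypothesis indepZ : independent_family P Z.
Hypothesis lawZ : forall i A, measurable A -> P (Z i @^-1` A) = Q A.
Local Open Scope ereal_scope.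

Let joint i j k l (f : (T * T) * (T * T) -> R) (uijkl : uniq [:: i; j; k; l])
    (mf : measurable_fun setT f) (f0 : forall z, (0 <= f z)%R) :
  \int[P]_w (f ((Z i w, Z j w), (Z k w, Z l w)))%:E =
  \int[Q]_z1 \int[Q]_z2 \int[Q]_z3 \int[Q]_z4 (f ((z1, z2), (z3, z4)))%:E.
Proof.
apply: (@ge0_integral_joint4 _ _ _ _ _ _ _ Q mZ indepZ lawZ _ _ _ _
  (EFin \o f) uijkl) => //.
exact/measurable_EFinP.
Qed.

(** The index modulo 4 closes the cycle: the last term is [k (Z 3, Z 0)]. *)
Definition hat_term (k : T * T -> R) (i : nat) (w : Omega) : R :=
  k (Z i w, Z (i.+1 %% 4) w).

(** [fine] would send an infinite potential to 0; the lemmas computing with [fpotential] work where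
    the potential is finite everywhere. *)
Definition fpotential (k : T * T -> R) (z : T) : R := fine (potential Q k z).

Definition mean (h : T * T -> R) : R := fine (\int[Q]_z potential Q h z).

(* [cond_term k i] is the conditional expectation of [hat_term k i] given [Z 0]
   and [Z 1]. *)
Definition cond_term (k : T * T -> R) (i : nat) (w : Omega) : R :=
  match i with
  | 0 => k (Z 0 w, Z 1 w)
  | 1 => fpotential k (Z 1 w)
  | 2 => mean k
  | _ => fpotential k (Z 0 w)
  end.

Let mproj1 : measurable_fun setT (fun p : (T * T) * (T * T) => p.1).
Proof. exact: measurable_fst. Qed.

Let mproj13 : measurable_fun setT (fun p : (T * T) * (T * T) => (p.1.1, p.2.1)).
Proof.
apply: measurable_fun_pair.
  exact: measurableT_comp measurable_fst measurable_fst.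
exact: measurableT_comp measurable_fst measurable_snd.
Qed.

Let mproj34 : measurable_fun setT (fun p : (T * T) * (T * T) => p.2).
Proof. exact: measurable_snd. Qed.

(** [k] and [l] are spare indices: the law of four copies is applied to an integrand that ignores
    the last two, whose integrals are those of a constant. *)
Lemma integral_pair_law i j k l (h : T * T -> R) : uniq [:: i; j; k; l] ->
  measurable_fun setT h -> (forall p, 0 <= h p)%R ->
  \int[P]_w (h (Z i w, Z j w))%:E = \int[Q]_z1 \int[Q]_z2 (h (z1, z2))%:E.
Proof.
move=> uijkl mh h0.
rewrite (joint uijkl (measurableT_comp mh mproj1))//=.
apply: eq_integral => z1 _; apply: eq_integral => z2 _.
by rewrite !integral_cst_probability.
Qed.

Section one_kernel.
Variables (k : T * T -> R).
Hypotheses (mk : measurable_fun setT k) (k0 : forall p, (0 <= k p)%R).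
Hypothesis phi_fin : forall z, potential Q k z \is a fin_num.
Hypothesis mean_fin : \int[Q]_z potential Q k z \is a fin_num.

Lemma measurable_fpotential : measurable_fun setT (fpotential k).
Proof.
exact: (measurableT_comp (fine_measurable measurableT)
  (measurable_potential Q mk k0)).
Qed.

Lemma fpotential_ge0 z : (0 <= fpotential k z)%R.
Proof. by rewrite fine_ge0// potential_ge0. Qed.

Lemma integral_kernel_law i j a b : uniq [:: i; j; a; b] ->
  \int[P]_w (k (Z i w, Z j w))%:E = \int[Q]_z potential Q k z.
Proof. by move=> u; rewrite (integral_pair_law u). Qed.

(* Conditionally on [Z i] and [Z j], the mean of [k (Z i, Z a)] is the potential
   of [k] at [Z i]. *)
Lemma integral_kernel_adjacent i j a b (h : T * T -> R) :
  uniq [:: i; j; a; b] -> measurable_fun setT h -> (forall p, 0 <= h p)%R ->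
  \int[P]_w (h (Z i w, Z j w) * k (Z i w, Z a w))%:E =
  \int[P]_w (h (Z i w, Z j w) * fpotential k (Z i w))%:E.
Proof.
move=> u mh h0.
rewrite (joint u (f := fun p => h p.1 * k (p.1.1, p.2.1))%R)//=; last 2 first.
- apply: measurable_funM; first exact: measurableT_comp mh mproj1.
  exact: (measurableT_comp mk mproj13).
- by move=> p; rewrite mulr_ge0.
rewrite (integral_pair_law u
  (h := fun p => h p * fpotential k p.1)%R)//=; last 2 first.
- apply: measurable_funM => //.
  exact: measurableT_comp measurable_fpotential measurable_fst.
- by move=> p; rewrite mulr_ge0// fpotential_ge0.
apply: eq_integral => z1 _; apply: eq_integral => z2 _.
under eq_integral do rewrite integral_cst_probability.
rewrite ge0_integralZl_real//; last exact: measurable_section_kernel.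
by rewrite EFinM fineK.
Qed.

(** The pair [(Z a, Z b)] is independent of [(Z i, Z j)], so its kernel averages to a constant. The
    weight [h] is arbitrary so that it may be an indicator of a conditioning event. *)
Lemma integral_kernel_opposite i j a b (h : T * T -> R) :
  uniq [:: i; j; a; b] -> measurable_fun setT h -> (forall p, 0 <= h p)%R ->
  \int[P]_w (h (Z i w, Z j w) * k (Z a w, Z b w))%:E =
  \int[P]_w (h (Z i w, Z j w) * fine (\int[Q]_z potential Q k z))%:E.
Proof.
move=> u mh h0.
rewrite (joint u (f := fun p => h p.1 * k p.2)%R)//=; last 2 first.
- apply: measurable_funM; first exact: measurableT_comp mh mproj1.
  exact: (measurableT_comp mk mproj34).
- by move=> p; rewrite mulr_ge0.
rewrite (integral_pair_law u
  (h := fun p => h p * fine (\int[Q]_z potential Q k z))%R)//=; last 2 first.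
- exact: measurable_funM.
- move=> p; rewrite mulr_ge0// fine_ge0//; apply: integral_ge0 => z _.
  exact: potential_ge0.
apply: eq_integral => z1 _; apply: eq_integral => z2 _.
under eq_integral => z3 _.
  rewrite ge0_integralZl_real//; last exact: measurable_section_kernel.
  over.
rewrite ge0_integralZl//.
- by rewrite EFinM fineK.
- exact: measurable_potential.
- by move=> z3 _; exact: potential_ge0.
- by rewrite lee_fin.
Qed.

End one_kernel.

(** Given [Z i], the copies [Z j] and [Z a] are independent, so the two kernels integrate separately
    to their potentials at [Z i]. The identity holds in the extended reals, so it also serves the
    infinite case. *)
Lemma integral_adjacent i j a b (k l : T * T -> R) : uniq [:: i; j; a; b] ->
  measurable_fun setT k -> measurable_fun setT l ->
  (forall p, 0 <= k p)%R -> (forall p, 0 <= l p)%R ->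
  \int[P]_w (k (Z i w, Z j w) * l (Z i w, Z a w))%:E = cross3 Q k l.
Proof.
move=> uq mk ml k0 l0.
rewrite (joint uq (f := fun p => k p.1 * l (p.1.1, p.2.1))%R)//=; last 2 first.
- apply: measurable_funM; first exact: measurableT_comp mk mproj1.
  exact: (measurableT_comp ml mproj13).
- by move=> p; rewrite mulr_ge0.
apply: eq_integral => z1 _; rewrite -ge0_integralZr//; last 3 first.
- exact/measurable_EFinP/measurable_section_kernel.
- by move=> z2 _; rewrite lee_fin.
- exact: potential_ge0.
apply: eq_integral => z2 _.
under eq_integral do rewrite integral_cst_probability.
rewrite ge0_integralZl_real//; exact: measurable_section_kernel.
Qed.

Section two_kernels.
Variables (C : R) (k l : T * T -> R) (u v : T -> R).
Hypotheses (qku : quasi_kernel C k u) (qlv : quasi_kernel C l v).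
Hypotheses (u_fin : \int[Q]_z (u z)%:E < +oo) (v_fin : \int[Q]_z (v z)%:E < +oo).
Hypothesis uv_fin : \int[Q]_z (u z * v z)%:E < +oo.
Let mk := qk_measurable qku.
Let ml := qk_measurable qlv.
Let k0 := qk_ge0 qku.
Let l0 := qk_ge0 qlv.
Let phi_fin := potential_fin_num qku u_fin.
Let lam_fin := potential_fin_num qlv v_fin.
Let mphi := measurable_fpotential mk k0.
Let mlam := measurable_fpotential ml l0.
Let phi0 := fpotential_ge0 k0.
Let lam0 := fpotential_ge0 l0.

Lemma mean_ge0 (h : T * T -> R) : (forall p, 0 <= h p)%R -> (0 <= mean h)%R.
Proof.
move=> h0; rewrite fine_ge0//; apply: integral_ge0 => z _; exact: potential_ge0.
Qed.

Lemma cross_fin_num : [/\ cross1 Q k l \is a fin_num,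
  \int[Q]_z potential Q k z \is a fin_num,
  \int[Q]_z potential Q l z \is a fin_num & cross3 Q k l \is a fin_num].
Proof.
have [c1 c2 c2' c3] := cross_lty qku qlv u_fin v_fin uv_fin.
split; rewrite ge0_fin_numE//.
- apply: integral_ge0 => z _; apply: integral_ge0 => z' _.
  by rewrite lee_fin mulr_ge0.
- by apply: integral_ge0 => z _; exact: potential_ge0.
- by apply: integral_ge0 => z _; exact: potential_ge0.
- by apply: integral_ge0 => z _; rewrite mule_ge0 ?potential_ge0.
Qed.

Lemma meanE : (mean k)%:E = \int[Q]_z potential Q k z.
Proof. by have [_ ? _ _] := cross_fin_num; rewrite fineK. Qed.

Lemma meanE' : (mean l)%:E = \int[Q]_z potential Q l z.
Proof. by have [_ _ ? _] := cross_fin_num; rewrite fineK. Qed.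

Lemma cross2E : (fine (cross2 Q k l))%:E = (mean k)%:E * (mean l)%:E.
Proof.
have [_ kf lf _] := cross_fin_num.
by rewrite fineK ?fin_numM// meanE meanE'.
Qed.

Section indices.
Variables (i j a b : nat).
Hypothesis uniq_ijab : uniq [:: i; j; a; b].

(** To average [k] or [l] over [Z j], the adjacent-pair lemma is used with [j] and [a] exchanged,
    conditioning on [Z i] and [Z a]. *)
Let uniq_iajb : uniq [:: i; a; j; b].
Proof.
rewrite -(@perm_uniq _ [:: i; j; a; b])// perm_cons.
exact: (permEl (perm_catCA [:: j] [:: a] [:: b])).
Qed.

Lemma expectation_same :
  \int[P]_w (k (Z i w, Z j w) * l (Z i w, Z j w))%:E = (fine (cross1 Q k l))%:E.
Proof.
have [c1 _ _ _] := cross_fin_num; rewrite fineK//.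
apply: (integral_pair_law uniq_ijab (h := fun p => k p * l p)%R).
- exact: measurable_funM.
- by move=> p; rewrite mulr_ge0.
Qed.

Lemma expectation_potential_potential :
  \int[P]_w (fpotential k (Z i w) * fpotential l (Z i w))%:E =
  (fine (cross3 Q k l))%:E.
Proof.
have [_ _ _ c3] := cross_fin_num; rewrite fineK//.
rewrite (integral_pair_law uniq_ijab
  (h := fun p => fpotential k p.1 * fpotential l p.1)%R)//=.
- apply: eq_integral => z _.
  by rewrite integral_cst_probability EFinM !fineK.
- by apply: measurable_funM; [exact: measurableT_comp mphi measurable_fst|
    exact: measurableT_comp mlam measurable_fst].
- by move=> p; rewrite mulr_ge0.
Qed.

Lemma expectation_potential_kernel :
  \int[P]_w (fpotential k (Z i w) * l (Z i w, Z j w))%:E =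
  (fine (cross3 Q k l))%:E.
Proof.
rewrite -expectation_potential_potential.
apply: (integral_kernel_adjacent (i := i) (j := a) (b := b) ml l0 lam_fin
  (h := fun p => fpotential k p.1)) => //.
- exact: measurableT_comp mphi measurable_fst.
Qed.

Lemma expectation_kernel_potential :
  \int[P]_w (k (Z i w, Z j w) * fpotential l (Z i w))%:E =
  (fine (cross3 Q k l))%:E.
Proof.
rewrite -expectation_potential_potential.
under eq_integral do rewrite mulrC.
under [RHS]eq_integral do rewrite mulrC.
apply: (integral_kernel_adjacent (i := i) (j := a) (b := b) mk k0 phi_fin
  (h := fun p => fpotential l p.1)) => //.
- exact: measurableT_comp mlam measurable_fst.
Qed.

Lemma expectation_adjacent :
  \int[P]_w (k (Z i w, Z j w) * l (Z i w, Z a w))%:E = (fine (cross3 Q k l))%:E.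
Proof.
have [_ _ _ c3] := cross_fin_num; rewrite fineK//.
exact: (integral_adjacent uniq_ijab).
Qed.

Lemma expectation_kernel_mean :
  \int[P]_w (k (Z i w, Z j w) * mean l)%:E = (fine (cross2 Q k l))%:E.
Proof.
under eq_integral do rewrite mulrC.
rewrite cross2E muleC meanE -(integral_kernel_law mk k0 uniq_ijab).
rewrite ge0_integralZl_real//.
- exact: measurableT_comp mk (measurable_fun_pair (mZ i) (mZ j)).
- exact: mean_ge0.
Qed.

Lemma expectation_opposite :
  \int[P]_w (k (Z i w, Z j w) * l (Z a w, Z b w))%:E = (fine (cross2 Q k l))%:E.
Proof.
have [_ _ lf _] := cross_fin_num.
rewrite -expectation_kernel_mean.
exact: (integral_kernel_opposite ml l0 lf uniq_ijab mk k0).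
Qed.

Lemma integral_potential :
  \int[P]_w (fpotential k (Z i w))%:E = (mean k)%:E.
Proof.
rewrite (integral_pair_law uniq_ijab (h := fun p => fpotential k p.1))//=.
- rewrite meanE; apply: eq_integral => z _.
  by rewrite integral_cst_probability fineK.
- exact: measurableT_comp mphi measurable_fst.
Qed.

Lemma expectation_potential_mean :
  \int[P]_w (fpotential k (Z i w) * mean l)%:E = (fine (cross2 Q k l))%:E.
Proof.
under eq_integral do rewrite mulrC.
rewrite cross2E muleC -integral_potential ge0_integralZl_real//.
- exact: measurableT_comp mphi (mZ i).
- exact: mean_ge0.
Qed.

Lemma expectation_potential_potential' :
  \int[P]_w (fpotential k (Z i w) * fpotential l (Z j w))%:E =
  (fine (cross2 Q k l))%:E.
Proof.
rewrite (integral_pair_law uniq_ijab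
  (h := fun p => fpotential k p.1 * fpotential l p.2)%R)//=.
- transitivity (\int[Q]_z (potential Q k z * (mean l)%:E)).
    apply: eq_integral => z _; rewrite ge0_integralZl_real// fineK//.
    by rewrite meanE'; congr (_ * _); apply: eq_integral => z' _; rewrite fineK.
  rewrite ge0_integralZr//.
  + by rewrite cross2E meanE.
  + exact: measurable_potential.
  + by move=> z _; exact: potential_ge0.
  + by rewrite lee_fin mean_ge0.
- by apply: measurable_funM; [exact: measurableT_comp mphi measurable_fst|
    exact: measurableT_comp mlam measurable_snd].
- by move=> p; rewrite mulr_ge0.
Qed.

End indices.

End two_kernels.

(** * The sixteen products for the hat and tilde versions *)

Section products.
Variables (C : R) (k l : T * T -> R) (u v : T -> R).
Hypotheses (qku : quasi_kernel C k u) (qlv : quasi_kernel C l v).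
Hypotheses (u_fin : \int[Q]_z (u z)%:E < +oo) (v_fin : \int[Q]_z (v z)%:E < +oo).
Hypothesis uv_fin : \int[Q]_z (u z * v z)%:E < +oo.

Let measurable_kernel (h : T * T -> R) i j : measurable_fun setT h ->
  measurable_fun setT (fun w => h (Z i w, Z j w)).
Proof.
by move=> mh; exact: measurableT_comp mh (measurable_fun_pair (mZ i) (mZ j)).
Qed.

Lemma measurable_cond_term (h : T * T -> R) i : measurable_fun setT h ->
  (forall p, 0 <= h p)%R -> measurable_fun setT (cond_term h i).
Proof.
move=> mh h0; have mp := measurable_fpotential mh h0.
case: i => [|[|[|i]]]; rewrite /cond_term//; first exact: measurable_kernel.
- exact: measurableT_comp mp (mZ 1%N).
- exact: measurableT_comp mp (mZ 0%N).
Qed.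

Lemma cond_term_ge0 (h : T * T -> R) i w : (forall p, 0 <= h p)%R ->
  (0 <= cond_term h i w)%R.
Proof.
by move=> h0; case: i => [|[|[|i]]] //=; rewrite ?fpotential_ge0 ?mean_ge0.
Qed.

Let I1 i j a b (uijab : uniq [:: i; j; a; b]) :=
  expectation_same qku qlv u_fin v_fin uv_fin uijab.
Let I2 i j a b (uijab : uniq [:: i; j; a; b]) :=
  expectation_opposite qku qlv u_fin v_fin uv_fin uijab.
Let I3 i j a b (uijab : uniq [:: i; j; a; b]) :=
  expectation_adjacent qku qlv u_fin v_fin uv_fin uijab.

(** Symmetry of the kernel moves the shared index to the first slot, as [expectation_adjacent]
    requires. *)
Let I3l i j a b (uijab : uniq [:: i; j; a; b]) :
  \int[P]_w (k (Z j w, Z i w) * l (Z i w, Z a w))%:E = (fine (cross3 Q k l))%:E.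
Proof. by under eq_integral do rewrite (qk_sym qku); exact: I3 uijab. Qed.

Let I3r i j a b (uijab : uniq [:: i; j; a; b]) :
  \int[P]_w (k (Z i w, Z j w) * l (Z a w, Z i w))%:E = (fine (cross3 Q k l))%:E.
Proof. by under eq_integral do rewrite (qk_sym qlv); exact: I3 uijab. Qed.

Lemma integral_hat_mul :
  P.-integrable setT
    (fun w => (alt4 (hat_term k) w * alt4 (hat_term l) w)%:E) /\
  \int[P]_w (alt4 (hat_term k) w * alt4 (hat_term l) w)%:E =
  (4 * (fine (cross1 Q k l) + fine (cross2 Q k l) - 2 * fine (cross3 Q k l)))%:E.
Proof.
(* Two edges of the 4-cycle coincide, share one vertex when [i + j] is odd, or are disjoint. The
   signs give 4 times E_1, 4 times E_2 and -8 times E_3. *)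
pose e (i j : nat) := if i == j then fine (cross1 Q k l) else
  if odd (i + j) then fine (cross3 Q k l) else fine (cross2 Q k l).
have [|||||I ->] := @integral_alt4_mul _ _ _ P (hat_term k) (hat_term l) e.
- by move=> i _; apply: measurable_kernel; exact: qk_measurable qku.
- by move=> i _; apply: measurable_kernel; exact: qk_measurable qlv.
- by move=> i w _; exact: qk_ge0 qku _.
- by move=> i w _; exact: qk_ge0 qlv _.
- move=> [|[|[|[|//]]]] [|[|[|[|//]]]] _ _; rewrite /hat_term /e /=.
  + exact: (@I1 0%N 1%N 2%N 3%N).
  + exact: (@I3l 1%N 0%N 2%N 3%N).
  + exact: (@I2 0%N 1%N 2%N 3%N).
  + exact: (@I3r 0%N 1%N 3%N 2%N).
  + exact: (@I3r 1%N 2%N 0%N 3%N).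
  + exact: (@I1 1%N 2%N 0%N 3%N).
  + exact: (@I3l 2%N 1%N 3%N 0%N).
  + exact: (@I2 1%N 2%N 3%N 0%N).
  + exact: (@I2 2%N 3%N 0%N 1%N).
  + exact: (@I3r 2%N 3%N 1%N 0%N).
  + exact: (@I1 2%N 3%N 0%N 1%N).
  + exact: (@I3l 3%N 2%N 0%N 1%N).
  + exact: (@I3l 0%N 3%N 1%N 2%N).
  + exact: (@I2 3%N 0%N 1%N 2%N).
  + exact: (@I3r 3%N 0%N 2%N 1%N).
  + exact: (@I1 3%N 0%N 1%N 2%N).
- split=> //; congr (_%:E).
  by rewrite !big_ord_recl !big_ord0 /e /= /bump /=; ring.
Qed.

Let vu_fin : \int[Q]_z (v z * u z)%:E < +oo.
Proof. by under eq_integral do rewrite mulrC. Qed.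

Let cross3C : cross3 Q l k = cross3 Q k l.
Proof. by apply: eq_integral => z _; rewrite muleC. Qed.

Let cross2C : cross2 Q l k = cross2 Q k l.
Proof. by rewrite /cross2 muleC. Qed.

Lemma integral_cond_mul :
  P.-integrable setT
    (fun w => (alt4 (cond_term k) w * alt4 (cond_term l) w)%:E) /\
  \int[P]_w (alt4 (cond_term k) w * alt4 (cond_term l) w)%:E =
  (fine (cross1 Q k l) + fine (cross2 Q k l) - 2 * fine (cross3 Q k l))%:E.
Proof.
pose c1 := fine (cross1 Q k l); pose c2 := fine (cross2 Q k l).
pose c3 := fine (cross3 Q k l).
(* Row [i], column [j] is the expectation of the [i]-th term for [k] times the [j]-th term for [l].
   The signed sums of rows 1, 2 and 3 vanish, so row 0 alone gives [c1 + c2 - 2 * c3]. *)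
pose e (i j : nat) := nth 0%R (nth [::] [:: [:: c1; c3; c2; c3];
  [:: c3; c3; c2; c2]; [:: c2; c2; c2; c2]; [:: c3; c2; c2; c3]] i) j.
have u01 : uniq [:: 0; 1; 2; 3]%N by [].
have u10 : uniq [:: 1; 0; 2; 3]%N by [].
have [|||||I ->] := @integral_alt4_mul _ _ _ P (cond_term k) (cond_term l) e.
- by move=> i _; exact: (measurable_cond_term _ (qk_measurable qku) (qk_ge0 qku)).
- by move=> i _; exact: (measurable_cond_term _ (qk_measurable qlv) (qk_ge0 qlv)).
- by move=> i w _; exact: (cond_term_ge0 _ _ (qk_ge0 qku)).
- by move=> i w _; exact: (cond_term_ge0 _ _ (qk_ge0 qlv)).
- move=> [|[|[|[|//]]]] [|[|[|[|//]]]] _ _; rewrite /cond_term /e /=.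
  + exact: (I1 u01).
  + under eq_integral do rewrite (qk_sym qku).
    exact: (expectation_kernel_potential qku qlv u_fin v_fin uv_fin u10).
  + exact: (expectation_kernel_mean qku qlv u_fin v_fin uv_fin u01).
  + exact: (expectation_kernel_potential qku qlv u_fin v_fin uv_fin u01).
  + under eq_integral do rewrite (qk_sym qlv).
    exact: (expectation_potential_kernel qku qlv u_fin v_fin uv_fin u10).
  + exact: (expectation_potential_potential qku qlv u_fin v_fin uv_fin u10).
  + exact: (expectation_potential_mean qku qlv u_fin v_fin uv_fin u10).
  + exact: (expectation_potential_potential' qku qlv u_fin v_fin uv_fin u10).
  (* In row 2 the constant [mean k] is on the left; the lemmas with the mean on the right apply
     after exchanging the two kernels, [cross2] being symmetric. *)
  + under eq_integral do rewrite mulrC.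
    rewrite /c2 -cross2C.
    exact: (expectation_kernel_mean qlv qku v_fin u_fin vu_fin u01).
  + under eq_integral do rewrite mulrC.
    rewrite /c2 -cross2C.
    exact: (expectation_potential_mean qlv qku v_fin u_fin vu_fin u10).
  + rewrite integral_cst_probability /c2.
    by rewrite (cross2E qku qlv u_fin v_fin uv_fin).
  + under eq_integral do rewrite mulrC.
    rewrite /c2 -cross2C.
    exact: (expectation_potential_mean qlv qku v_fin u_fin vu_fin u01).
  + exact: (expectation_potential_kernel qku qlv u_fin v_fin uv_fin u01).
  + exact: (expectation_potential_potential' qku qlv u_fin v_fin uv_fin u01).
  + exact: (expectation_potential_mean qku qlv u_fin v_fin uv_fin u01).
  + exact: (expectation_potential_potential qku qlv u_fin v_fin uv_fin u01).
- split=> //; congr (_%:E).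
  by rewrite !big_ord_recl !big_ord0 /e /= /bump /= -/c1 -/c2 -/c3; ring.
Qed.

End products.

End conditioning.

(** * Conditional expectations *)

Section conditional_expectation_unique.
Context {d : measure_display} {R : realType} {Omega : measurableType d}.
Variable P : probability Omega R.
Local Open Scope ereal_scope.

(** The event [g1 < g2] belongs to the sub-sigma-algebra, so [g1] and [g2] have the same integral
    over it, that of [f]; the positive function [g2 - g1] then has zero integral there. *)
Lemma cond_expectation_le (G0 : set (set Omega)) (f g1 g2 : Omega -> R) :
  <<s G0 >> `<=` measurable ->
  is_cond_expectation P <<s G0 >> f g1 -> is_cond_expectation P <<s G0 >> f g2 ->
  {ae P, forall w, (g2 w <= g1 w)%R}.
Proof.
move=> G0m [mg1 ig1 e1] [mg2 ig2 e2].
pose A := [set w | (g1 w < g2 w)%R].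
have GA : <<s G0 >> A.
  have m1 : measurable_fun setT (g1 : g_sigma_algebraType G0 -> R).
    by move=> _ B mB; rewrite setTI; exact: mg1.
  have m2 : measurable_fun setT (g2 : g_sigma_algebraType G0 -> R).
    by move=> _ B mB; rewrite setTI; exact: mg2.
  have := measurable_funB m2 m1 measurableT (measurable_itv `]0%R, +oo[).
  rewrite setTI (_ : _ @^-1` _ = A)//.
  by apply/seteqP; split => w /=; rewrite in_itv/= andbT subr_gt0.
have mA : measurable A by exact: G0m.
have i1 : P.-integrable A (EFin \o g1) by exact: integrableS ig1.
have i2 : P.-integrable A (EFin \o g2) by exact: integrableS ig2.
have I0 : \int[P]_(w in A) (g2 w - g1 w)%:E = 0.
  rewrite integralB_EFin// e1// e2// subee// -e1//.
  exact: integrable_fin_num.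
have : \int[P]_(w in A) `|(g2 w - g1 w)%:E| = 0.
  rewrite -[RHS]I0; apply: eq_integral => w; rewrite inE => /ltW Aw.
  by rewrite gee0_abs// lee_fin subr_ge0.
have mB : measurable_fun A (fun w => (g2 w - g1 w)%:E).
  by have := measurable_int _ (integrableB mA i2 i1).
move/(ae_eq_integral_abs P mA mB); apply: filterS => w /= Aw.
rewrite leNgt; apply/negP => g12; have := Aw g12.
by move=> /eqP; rewrite eqe subr_eq0 gt_eqF.
Qed.

Lemma cond_expectation_unique (G0 : set (set Omega)) (f g1 g2 : Omega -> R) :
  <<s G0 >> `<=` measurable ->
  is_cond_expectation P <<s G0 >> f g1 -> is_cond_expectation P <<s G0 >> f g2 ->
  {ae P, forall w, g1 w = g2 w}.
Proof.
move=> G0m h1 h2; have := cond_expectation_le G0m h1 h2.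
apply: filterS2 (cond_expectation_le G0m h2 h1) => w g12 g21.
by apply/eqP; rewrite eq_le g12 g21.
Qed.

Lemma g_sigma_preimageU_measurable d1 d2 (T1 : measurableType d1)
    (T2 : measurableType d2) (f1 : Omega -> T1) (f2 : Omega -> T2) :
  measurable_fun setT f1 -> measurable_fun setT f2 ->
  g_sigma_preimageU f1 f2 `<=` measurable.
Proof.
move=> m1 m2; apply: smallest_sub; first exact: sigma_algebra_measurable.
by rewrite subUset; split=> A [B mB <-]; [exact: m1|exact: m2].
Qed.

Lemma cond_expectation_measurable (G : set (set Omega)) (f g : Omega -> R) :
  G `<=` measurable -> is_cond_expectation P G f g -> measurable_fun setT g.
Proof. by move=> Gm [mg _ _] _ B mB; rewrite setTI; apply: Gm; exact: mg. Qed.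

(** Transfers integrability and value of the product from the explicit versions to arbitrary ones,
    known only up to null sets. *)
Lemma ae_eq_integral_mul (f1 f2 g1 g2 : Omega -> R) :
  measurable_fun setT f1 -> measurable_fun setT g1 ->
  {ae P, forall w, f1 w = f2 w} -> {ae P, forall w, g1 w = g2 w} ->
  P.-integrable setT (fun w => (f2 w * g2 w)%:E) ->
  P.-integrable setT (fun w => (f1 w * g1 w)%:E) /\
  \int[P]_w (f1 w * g1 w)%:E = \int[P]_w (f2 w * g2 w)%:E.
Proof.
move=> mf mg f12 g12 i2.
have m1 : measurable_fun setT (fun w => (f1 w * g1 w)%:E).
  by apply/measurable_EFinP; exact: measurable_funM.
have m2 := measurable_int _ i2.
have fg12 : ae_eq P setT (fun w => (f1 w * g1 w)%:E) (fun w => (f2 w * g2 w)%:E).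
  by apply: filterS2 f12 g12 => w -> ->.
split; last exact: ae_eq_integral.
move/integrableP : (i2) => [_ i2oo]; apply/integrableP; split => //.
apply: le_lt_trans i2oo; rewrite le_eqVlt; apply/orP; left; apply/eqP.
apply: ae_eq_integral => //; try exact: measurableT_comp.
exact: ae_eq_abse.
Qed.

End conditional_expectation_unique.

(** * An explicit version of the conditional expectation of the hat sum *)

Section conditional_expectation_hat.
Context {d dT dS : measure_display} {R : realType}.
Context {Omega : measurableType d} {T : measurableType dT} {S : measurableType dS}.
Context (P : probability Omega R) (Z : nat -> Omega -> T) (Q : probability T R).
Hypothesis mZ : forall i, measurable_fun setT (Z i).
Hypothesis indepZ : independent_family P Z.
Hypothesis lawZ : forall i A, measurable A -> P (Z i @^-1` A) = Q A.
Variables (proj : T -> S) (k0 : S * S -> R) (C : R) (u : T -> R).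
Hypothesis mproj : measurable_fun setT proj.
Hypothesis mk0 : measurable_fun setT k0.
Hypothesis k0_ge0 : forall p, 0 <= k0 p.
(** With [proj] a coordinate of a pair, the kernel sees only the [X] part or only the [Y] part,
    while the copies [Z i] carry both; conditioning is on the projected copies. *)
Let k (p : T * T) : R := k0 (proj p.1, proj p.2).
Hypothesis qk : quasi_kernel C k u.
Local Open Scope ereal_scope.
Hypothesis u_fin : \int[Q]_z (u z)%:E < +oo.

Let mk := qk_measurable qk.
Let kge0 := qk_ge0 qk.
Let phi_fin := potential_fin_num qk u_fin.
Let mphi := measurable_fpotential Q mk kge0 : measurable_fun setT (fpotential Q k).
Let phi_ge0 := fpotential_ge0 Q kge0.

Let mean_fin : \int[Q]_z potential Q k z \is a fin_num.
Proof.
rewrite ge0_fin_numE; first exact: (integral_potential_fin qk).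
by apply: integral_ge0 => z _; exact: potential_ge0.
Qed.

Let potential_law i j a b : uniq [:: i; j; a; b] ->
  \int[P]_w (fpotential Q k (Z i w))%:E = (mean Q k)%:E.
Proof.
move=> uq.
rewrite (integral_pair_law mZ indepZ lawZ uq
  (h := fun p => fpotential Q k p.1))//=.
- rewrite /mean fineK//; apply: eq_integral => z _.
  by rewrite integral_cst_probability fineK.
- exact: measurableT_comp mphi measurable_fst.
Qed.

Let kernel_law i j a b (uq : uniq [:: i; j; a; b]) :=
  integral_kernel_law mZ indepZ lawZ mk kge0 uq.

Let mean_lt : \int[Q]_z potential Q k z < +oo.
Proof. exact: (integral_potential_fin qk). Qed.

Lemma integrable_hat_term i : (i < 4)%N ->
  P.-integrable setT (EFin \o hat_term Z k i).
Proof.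
move=> i4; apply: integrable_ge0_fin.
- exact: measurableT_comp mk (measurable_fun_pair (mZ _) (mZ _)).
- by move=> w; exact: kge0.
- rewrite /hat_term; move: i i4 => [|[|[|[|//]]]] _ /=.
  + by rewrite (@kernel_law 0%N 1%N 2%N 3%N).
  + by rewrite (@kernel_law 1%N 2%N 0%N 3%N).
  + by rewrite (@kernel_law 2%N 3%N 0%N 1%N).
  + by rewrite (@kernel_law 3%N 0%N 1%N 2%N).
Qed.

Lemma integrable_cond_term i : (i < 4)%N ->
  P.-integrable setT (EFin \o cond_term Z Q k i).
Proof.
move=> i4; apply: integrable_ge0_fin.
- exact: measurable_cond_term.
- by move=> w; exact: cond_term_ge0.
- rewrite /cond_term; move: i i4 => [|[|[|[|//]]]] _ /=.
  + by rewrite (@kernel_law 0%N 1%N 2%N 3%N).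
  + by rewrite (@potential_law 1%N 0%N 2%N 3%N)// ltry.
  + by rewrite integral_cst_probability ltry.
  + by rewrite (@potential_law 0%N 1%N 2%N 3%N)// ltry.
Qed.

Let G := g_sigma_preimageU (proj \o Z 0%N) (proj \o Z 1%N).

Let G_preimage A : G A ->
  exists2 E : set (S * S), measurable E &
    A = (fun w => (proj (Z 0%N w), proj (Z 1%N w))) @^-1` E.
Proof.
pose V w := (proj (Z 0%N w), proj (Z 1%N w)).
rewrite /G (_ : proj \o Z 0%N = fst \o V)// (_ : proj \o Z 1%N = snd \o V)//.
by rewrite g_sigma_preimageU_comp => -[E mE <-]; exists E => //; rewrite setTI.
Qed.

(** The indicator of the conditioning event is a nonnegative function of [(Z 0, Z 1)] and plays the
    role of the weight [h] in the adjacent and opposite lemmas. *)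
Let cond_termE E i : measurable E -> (i < 4)%N ->
  \int[P]_(w in (fun w => (proj (Z 0%N w), proj (Z 1%N w))) @^-1` E)
    (cond_term Z Q k i w)%:E =
  \int[P]_(w in (fun w => (proj (Z 0%N w), proj (Z 1%N w))) @^-1` E)
    (hat_term Z k i w)%:E.
Proof.
move=> mE i4; pose b (p : T * T) : R := \1_E (proj p.1, proj p.2).
have mb : measurable_fun setT b.
  apply: (measurableT_comp (measurable_indic mE)).
  apply: measurable_fun_pair.
    exact: measurableT_comp mproj measurable_fst.
  exact: measurableT_comp mproj measurable_snd.
have b0 p : (0 <= b p)%R by rewrite /b indicE.
have bE (f : Omega -> R) :
    \int[P]_(w in (fun w => (proj (Z 0%N w), proj (Z 1%N w))) @^-1` E) (f w)%:E =
    \int[P]_w (b (Z 0%N w, Z 1%N w) * f w)%:E.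
  rewrite integral_mkcond; apply: eq_integral => w _.
  rewrite patchE /b indicE/=.
  have -> : (w \in (fun w => (proj (Z 0%N w), proj (Z 1%N w))) @^-1` E) =
            ((proj (Z 0%N w), proj (Z 1%N w)) \in E).
    by apply/idP/idP; rewrite !inE.
  by case: (_ \in E); rewrite ?mul1r ?mul0r.
rewrite !bE.
(* Term 1 is averaged around [Z 1], so the adjacent lemma is used for the pair [(Z 1, Z 0)] and the
   indicator takes its arguments in reverse. *)
pose b' (p : T * T) := b (p.2, p.1).
have mb' : measurable_fun setT b'.
  exact: measurableT_comp mb (measurable_fun_pair measurable_snd measurable_fst).
have b'0 p : (0 <= b' p)%R by exact: b0.
move: i i4 => [|[|[|[|//]]]] _; rewrite /hat_term /cond_term //=.
- by apply/esym; exact: (integral_kernel_adjacent mZ indepZ lawZ mk kge0 phi_fin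
    (i := 1%N) (j := 0%N) (a := 2%N) (b := 3%N) _ mb' b'0).
- by apply/esym; exact: (integral_kernel_opposite mZ indepZ lawZ mk kge0 mean_fin
    (i := 0%N) (j := 1%N) (a := 2%N) (b := 3%N) _ mb b0).
- under [RHS]eq_integral do rewrite (qk_sym qk).
  by apply/esym; exact: (integral_kernel_adjacent mZ indepZ lawZ mk kge0 phi_fin
    (i := 0%N) (j := 1%N) (a := 3%N) (b := 2%N) _ mb b0).
Qed.

Let mcond_G B : measurable B -> G (alt4 (cond_term Z Q k) @^-1` B).
Proof.
(* The potential at [z] factors through [proj z]; this is what makes it measurable for the
   sigma-algebra of the projected copies. *)
pose pot0 (s : S) : R := fine (\int[Q]_z' (k0 (s, proj z'))%:E).
have mpot0 : measurable_fun setT pot0.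
  apply: (measurableT_comp (fine_measurable measurableT)).
  apply: (measurable_fun_fubini_tonelli_F
    (fun p : S * T => (k0 (p.1, proj p.2))%:E)) => /=.
  - apply/measurable_EFinP; apply: (measurableT_comp mk0).
    apply: measurable_fun_pair; first exact: measurable_fst.
    exact: measurableT_comp mproj measurable_snd.
  - by move=> p; rewrite lee_fin.
(* [Os] is [Omega] with the smaller sigma-algebra, so measurability for [G] becomes ordinary
   measurability on [Os]. *)
pose Os := g_sigma_algebraType
  (preimage_set_system setT (proj \o Z 0%N) measurable `|`
   preimage_set_system setT (proj \o Z 1%N) measurable).
have m0 : measurable_fun setT (fun w : Os => proj (Z 0%N w)).
  by move=> _ D mD; apply: sub_sigma_algebra; left; exists D.
have m1 : measurable_fun setT (fun w : Os => proj (Z 1%N w)).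
  by move=> _ D mD; apply: sub_sigma_algebra; right; exists D.
move=> mB.
suff mc : measurable_fun setT (alt4 (cond_term Z Q k) : Os -> R).
  by have := mc measurableT B mB; rewrite setTI.
apply: measurable_funB; last exact: measurableT_comp mpot0 m0.
apply: measurable_funD; last exact: measurable_cst.
apply: measurable_funB; last exact: measurableT_comp mpot0 m1.
exact: (measurableT_comp mk0 (measurable_fun_pair m0 m1)).
Qed.

Lemma cond_expectation_hat :
  is_cond_expectation P G (alt4 (hat_term Z k)) (alt4 (cond_term Z Q k)).
Proof.
split; first exact: mcond_G.
- by apply: integrable_alt4; exact: integrable_cond_term.
- move=> A GA; have [E mE ->] := G_preimage GA.
  apply: eq_integral_alt4.
  + apply: (measurable_preimageT _ mE); apply: measurable_fun_pair.
      exact: measurableT_comp mproj (mZ 0%N).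
    exact: measurableT_comp mproj (mZ 1%N).
  + exact: integrable_cond_term.
  + exact: integrable_hat_term.
  + by move=> i i4; exact: cond_termE.
Qed.

End conditional_expectation_hat.

(** * Kernels of metric spaces *)

Section metric_kernel.
Context {dT : measure_display} {R : realType} {T : measurableType dT}.
Context {S : pmetricType R}.
Variables (a : R) (xo : S) (proj : T -> borelType S).
Hypotheses (a_gt0 : 0 < a) (sepS : separable S).
Hypothesis mproj : measurable_fun setT proj.

Definition dist_kernel (p : borelType S * borelType S) : R :=
  'd((p.1 : S), (p.2 : S)) `^ a.

Lemma measurable_dist_kernel : measurable_fun setT dist_kernel.
Proof. exact: (measurableT_comp (measurable_powR a) (measurable_mdist sepS)). Qed.

(** From [s + t <= 2 * max s t], monotonicity of the power, and the bound of a maximum by a sum. The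
    constant [2 ^ a] is uniform in exponents below and above 1. *)
Lemma powR_quasi_triangle (r s t : R) : 0 <= r -> 0 <= s -> 0 <= t ->
  r <= s + t -> r `^ a <= 2 `^ a * (s `^ a + t `^ a).
Proof.
move=> r0 s0 t0 rst; pose m := Num.max s t.
have m0 : 0 <= m by rewrite le_max s0.
have rm : r <= 2 * m.
  apply: le_trans rst _; rewrite mulr_natl mulr2n.
  by apply: lerD; rewrite le_max lexx ?orbT.
apply: le_trans (_ : (2 * m) `^ a <= _).
  by apply: ge0_ler_powR; rewrite ?nnegrE ?mulr_ge0// ltW.
rewrite powRM//; apply: ler_wpM2l; first exact: powR_ge0.
by rewrite /m; case: (leP s t) => _; rewrite ?lerDl ?lerDr powR_ge0.
Qed.

Lemma quasi_kernel_dist : quasi_kernel (2 `^ a)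
  (fun p : T * T => dist_kernel (proj p.1, proj p.2))
  (fun z => 'd((proj z : S), xo) `^ a).
Proof.
split.
- apply: (measurableT_comp measurable_dist_kernel).
  apply: measurable_fun_pair.
    exact: measurableT_comp mproj measurable_fst.
  exact: measurableT_comp mproj measurable_snd.
- exact: (measurableT_comp measurable_dist_kernel
    (measurable_fun_pair mproj (measurable_cst (xo : borelType S)))).
- by move=> p; exact: powR_ge0.
- by move=> z; exact: powR_ge0.
- exact: powR_ge0.
- by move=> z z'; rewrite /dist_kernel/= metric_sym.
- move=> z z'; apply: powR_quasi_triangle; rewrite ?mdist_ge0//=.
  by rewrite (metric_sym (proj z')); exact: metric_triangle.
- move=> z z'; apply: powR_quasi_triangle; rewrite ?mdist_ge0//=.
  exact: metric_triangle.
Qed.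

End metric_kernel.

(** A potential vanishing at [z] forces the distance from [X] to [proj z] to be zero almost surely,
    which would make [X] degenerate. *)
Lemma nondegenerate_potential_gt0 {d dT : measure_display} {R : realType}
    {Omega : measurableType d} {T : measurableType dT} {S : pmetricType R}
    (P : probability Omega R) (W : {RV P >-> T}) (a : R)
    (proj : T -> borelType S) (X : {RV P >-> borelType S}) :
  0 < a -> separable S -> measurable_fun setT proj ->
  (forall w, proj (W w) = X w) -> ~ degenerate X ->
  forall z, (0 < potential (distribution P W)
    (fun p => dist_kernel a (proj p.1, proj p.2)) z)%E.
Proof.
move=> a0 sepS mproj projW nX z.
set k := (X in potential _ X).
have [mk _ k0 _ _ _ _ _] := quasi_kernel_dist (proj z : S) a0 sepS mproj.
have mkz : measurable_fun setT (fun z' => (k (z, z'))%:E).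
  exact/measurable_EFinP/(measurable_section_kernel mk z).
rewrite lt_neqAle potential_ge0 ?andbT//; apply/eqP => /esym.
rewrite /potential (ge0_integral_distribution W mkz); last first.
  by move=> z'; rewrite lee_fin; exact: k0.
move=> I0; apply: nX; exists (proj z : S).
have mkW : measurable_fun setT (fun w => (k (z, W w))%:E).
  exact: (measurableT_comp mkz (measurable_funPT W)).
have k0W w : (0 <= (k (z, W w))%:E)%E by rewrite lee_fin; exact: k0.
apply: filterS (ge0_integral_eq0 mkW k0W I0) => w /eqP.
rewrite eqe => /eqP/powR_eq0_eq0 dw.
by rewrite -projW; apply: mdist_positivity; rewrite metric_sym.
Qed.

(** * From abstract kernels to the distance covariances *)

Lemma adde3_lty {R : realType} (x y z : \bar R) :
  (0 <= x -> 0 <= y -> 0 <= z -> x + y + z < +oo ->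
   [/\ x < +oo, y < +oo & z < +oo])%E.
Proof.
by case: x => [x| |]; case: y => [y| |]; case: z => [z| |]; split;
  rewrite ?ltry.
Qed.

(* The copies (Xs i, Ys i) may live on another probability space than (X, Y). *)
Theorem theorem8p1 (R : realType) (alpha : R) (alpha_gt0 : 0 < alpha)
    (SX SY : pmetricType R) (sepX : separable SX) (sepY : separable SY)
    (xo : SX) (yo : SY)
    (d : measure_display) (Omega : measurableType d) (P : probability Omega R)
    (X : {RV P >-> borelType SX}) (Y : {RV P >-> borelType SY})
    (d' : measure_display) (Omega' : measurableType d')
    (P' : probability Omega' R)
    (Xs : nat -> {RV P' >-> borelType SX}) (Ys : nat -> {RV P' >-> borelType SY})
    (copies : independent_copies P' (fun i w => (Xs i w, Ys i w))
                                 P (fun w => (X w, Y w))) :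
  ((moment_sum alpha xo yo X Y < +oo)%E ->
     [/\ [/\ E1 alpha Xs Ys \is a fin_num,
             'E_P'[dist_pow alpha Xs 0 1]%E \is a fin_num,
             'E_P'[dist_pow alpha Ys 0 1]%E \is a fin_num &
             E3 alpha Xs Ys \is a fin_num],
         dcov_star alpha Xs Ys \is a fin_num,
         is_dcov_hat alpha Xs Ys (dcov_star alpha Xs Ys) &
         is_dcov_tilde alpha Xs Ys (dcov_star alpha Xs Ys)])
  /\
  (moment_sum alpha xo yo X Y = +oo%E -> ~ degenerate X -> ~ degenerate Y ->
     (E1 alpha Xs Ys + E2 alpha Xs Ys = +oo)%E /\ E3 alpha Xs Ys = +oo%E).
Proof.
have [indepZ lawZ0] := copies.
pose T := (borelType SX * borelType SY)%type.
have mW : measurable_fun setT (fun w => (X w, Y w) : T).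
  exact: (measurable_fun_pair (measurable_funPT X) (measurable_funPT Y)).
pose W : {RV P >-> T} := HB.pack (fun w => (X w, Y w) : T)
  (isMeasurableFun.Build _ _ _ _ _ mW).
pose Q : probability T R := distribution P W.
pose Z (i : nat) (w : Omega') : T := (Xs i w, Ys i w).
have mZ i : measurable_fun setT (Z i).
  exact: (measurable_fun_pair (measurable_funPT (Xs i)) (measurable_funPT (Ys i))).
have lawZ i A : measurable A -> P' (Z i @^-1` A) = Q A by exact: lawZ0.
(* Both kernels live on pairs of points of the product space, which keeps the dependence between [X]
   and [Y] inside the single law [Q]. *)
pose k (p : T * T) : R := dist_kernel alpha (p.1.1, p.2.1).
pose l (p : T * T) : R := dist_kernel alpha (p.1.2, p.2.2).
pose u (z : T) : R := 'd((z.1 : SX), xo) `^ alpha.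
pose v (z : T) : R := 'd((z.2 : SY), yo) `^ alpha.
have qku : quasi_kernel (2 `^ alpha) k u.
  exact: (quasi_kernel_dist xo alpha_gt0 sepX measurable_fst).
have qlv : quasi_kernel (2 `^ alpha) l v.
  exact: (quasi_kernel_dist yo alpha_gt0 sepY measurable_snd).
have mk := qk_measurable qku; have ml := qk_measurable qlv.
have k0 := qk_ge0 qku; have l0 := qk_ge0 qlv.
have mu := qk_radius_measurable qku; have mv := qk_radius_measurable qlv.
have u0 := qk_radius_ge0 qku; have v0 := qk_radius_ge0 qlv.
have EW (f : T -> R) : measurable_fun setT f -> (forall z, 0 <= f z) ->
    ('E_P[fun w => f (W w)] = \int[Q]_z (f z)%:E)%E.
  move=> mf f0; rewrite unlock (ge0_integral_distribution W)//.
  exact/measurable_EFinP.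
have sumE : moment_sum alpha xo yo X Y = (\int[Q]_z (u z)%:E +
    \int[Q]_z (v z)%:E + \int[Q]_z (u z * v z)%:E)%E.
  rewrite -!EW//; first exact: measurable_funM.
  by move=> z; rewrite mulr_ge0.
(* These identities concern integrals of nonnegative functions and hold before any finiteness is
   known, so both halves of the theorem use them. *)
have E1E : E1 alpha Xs Ys = cross1 Q k l.
  rewrite /E1 unlock.
  apply: (integral_pair_law mZ indepZ lawZ (i := 0%N) (j := 1%N) (k := 2%N)
    (l := 3%N) (h := fun p => k p * l p)) => //.
    exact: measurable_funM.
  by move=> p; rewrite mulr_ge0.
have kE : ('E_P'[dist_pow alpha Xs 0 1] = \int[Q]_z potential Q k z)%E.
  rewrite unlock.
  exact: (integral_kernel_law mZ indepZ lawZ mk k0 (i := 0%N) (j := 1%N)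
    (a := 2%N) (b := 3%N)).
have lE : ('E_P'[dist_pow alpha Ys 0 1] = \int[Q]_z potential Q l z)%E.
  rewrite unlock.
  exact: (integral_kernel_law mZ indepZ lawZ ml l0 (i := 0%N) (j := 1%N)
    (a := 2%N) (b := 3%N)).
have E2E : E2 alpha Xs Ys = cross2 Q k l by rewrite /E2 kE lE.
have E3E : E3 alpha Xs Ys = cross3 Q k l.
  rewrite /E3 unlock.
  exact: (integral_adjacent mZ indepZ lawZ (i := 0%N) (j := 1%N) (a := 2%N)
    (b := 3%N)).
split=> [sum_fin|sum_inf nX nY]; last first.
  rewrite E1E E2E E3E; apply: (cross_eqy qku qlv); first by rewrite -sumE.
    exact: (nondegenerate_potential_gt0 (W := W) (X := X) alpha_gt0 sepX
      measurable_fst).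
  exact: (nondegenerate_potential_gt0 (W := W) (X := Y) alpha_gt0 sepY
    measurable_snd).
have [u_fin v_fin uv_fin] : [/\ (\int[Q]_z (u z)%:E < +oo)%E,
    (\int[Q]_z (v z)%:E < +oo)%E & (\int[Q]_z (u z * v z)%:E < +oo)%E].
  have U0 : (0 <= \int[Q]_z (u z)%:E)%E.
    by apply: integral_ge0 => z _; rewrite lee_fin.
  have V0 : (0 <= \int[Q]_z (v z)%:E)%E.
    by apply: integral_ge0 => z _; rewrite lee_fin.
  have W0 : (0 <= \int[Q]_z (u z * v z)%:E)%E.
    by apply: integral_ge0 => z _; rewrite lee_fin mulr_ge0.
  rewrite sumE in sum_fin; exact (adde3_lty U0 V0 W0 sum_fin).
have [c1_fin kfin lfin c3_fin] := cross_fin_num qku qlv u_fin v_fin uv_fin.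
have c2_fin : cross2 Q k l \is a fin_num := fin_numM kfin lfin.
have starE : dcov_star alpha Xs Ys = (fine (cross1 Q k l) +
    fine (cross2 Q k l) - 2 * fine (cross3 Q k l))%:E.
  rewrite /dcov_star E1E E2E E3E EFinB [X in _ = (X - _)%E]EFinD EFinM.
  by rewrite (fineK c1_fin) (fineK c2_fin) (fineK c3_fin).
have hatXE : hat alpha Xs = alt4 (hat_term Z k) by [].
have hatYE : hat alpha Ys = alt4 (hat_term Z l) by [].
have condX : is_tilde (P := P') alpha Xs (alt4 (cond_term Z Q k)).
  apply: (cond_expectation_hat mZ indepZ lawZ measurable_fst
    (measurable_dist_kernel alpha sepX) _ qku u_fin) => p.
  exact: powR_ge0.
have condY : is_tilde (P := P') alpha Ys (alt4 (cond_term Z Q l)).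
  apply: (cond_expectation_hat mZ indepZ lawZ measurable_snd
    (measurable_dist_kernel alpha sepY) _ qlv v_fin) => p.
  exact: powR_ge0.
split.
- rewrite E1E kE lE E3E; exact (And4 c1_fin kfin lfin c3_fin).
- rewrite starE; exact isT.
- have [hint hE] := integral_hat_mul mZ indepZ lawZ qku qlv u_fin v_fin uv_fin.
  split; first by rewrite hatXE hatYE.
  rewrite unlock hatXE hatYE hE starE -EFinM; congr (_%:E).
  by rewrite mulrA mulVf ?mul1r// pnatr_eq0.
- split.
  + split; [rewrite hatXE|rewrite hatYE]; apply: integrable_alt4 => i i4.
      exact: (integrable_hat_term mZ indepZ lawZ (proj := fst)
        (k0 := dist_kernel alpha) qku u_fin i4).
    exact: (integrable_hat_term mZ indepZ lawZ (proj := snd)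
      (k0 := dist_kernel alpha) qlv v_fin i4).
  + by split; [exists (alt4 (cond_term Z Q k))|exists (alt4 (cond_term Z Q l))].
  (* Arbitrary versions agree almost surely with the explicit ones, for which integrability and
     value are already computed. *)
  + move=> tX tY tildeX tildeY.
    have GX := g_sigma_preimageU_measurable (measurable_funPT (Xs 0%N))
      (measurable_funPT (Xs 1%N)).
    have GY := g_sigma_preimageU_measurable (measurable_funPT (Ys 0%N))
      (measurable_funPT (Ys 1%N)).
    have [cint cE] := integral_cond_mul mZ indepZ lawZ qku qlv u_fin v_fin uv_fin.
    have [tint tE] := ae_eq_integral_mul (cond_expectation_measurable GX tildeX)
      (cond_expectation_measurable GY tildeY)
      (cond_expectation_unique GX tildeX condX)
      (cond_expectation_unique GY tildeY condY) cint.
    split; first exact tint.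
    by rewrite unlock starE -cE; exact tE.
Qed.
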